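(* Let $H$ be a digraph and let $s\in\mathbb{N}$. Then there is a function $f\colon\mathbb{N}\to\mathbb{N}$ such that for every $s$-semicomplete digraph $G$ and every positive integer $k$, one of the following holds: (1) $G$ has $k$ pairwise vertex-disjoint subdigraphs, each containing $H$ as a strong minor; or (2) there is a set $X\subseteq V(G)$ with $|X|\le f(k)$ such that $G\setminus X$ does not contain $H$ as a strong minor. Moreover, if $H$ is strongly-connected, then for every $s\in\mathbb{N}$ there is a function $f\colon\mathbb{N}\to\mathbb{N}$ such that the same dichotomy holds with ''strong minor'' replaced by ''butterfly minor'', and also one with ''strong minor'' replaced by ''topological minor''.
   Context: Digraphs are finite, may have multiple arcs, but have no loops. A digraph is strongly-connected if it has at least one vertex and for all vertices $u,v$ there is a directed path from $u$ to $v$ (so the one-vertex digraph is strongly-connected). A digraph $G$ on $n$ vertices is $s$-semicomplete if every vertex $v$ is adjacent (by an arc in either direction) to at least $n-1-s$ of the other vertices, i.e. $v$ has at most $s$ non-neighbours. $G\setminus X$ denotes the digraph obtained by deleting the vertices of $X$. An arc $(u,v)$ is contractible if it is the only arc with head $v$, or the only arc with tail $u$. $H$ is a butterfly minor of $G$ if a digraph isomorphic to $H$ can be obtained from a subdigraph of $G$ by repeatedly contracting contractible arcs (deleting the arc, identifying its endpoints and deleting resulting loops). $H$ is a strong minor of $G$ if a digraph isomorphic to $H$ can be obtained from a subdigraph of $G$ by repeatedly contracting strongly-connected subdigraphs to single vertices (identifying all their vertices into one vertex and deleting arcs with both ends in the contracted set). $H$ is a topological minor of $G$ if $G$ has a subdigraph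 obtained from a digraph isomorphic to $H$ by replacing each arc by a directed path in the same direction, these paths being pairwise internally vertex-disjoint. *)

(* Defs.v *)
From HB Require Import structures.
From mathcomp Require Import all_boot.
From Stdlib Require Import Relation_Operators.

Set Implicit Arguments.
Unset Strict Implicit.
Unset Printing Implicit Defensive.

(* The null digraph (no vertices) is allowed. *)
Record digraph := Digraph {
  vertex : finType;
  darc : finType;
  dtail : darc -> vertex;
  dhead : darc -> vertex;
  loopless : forall e, dtail e != dhead e }.

Definition digraph_iso (G H : digraph) : Prop :=
  exists (f : vertex G -> vertex H) (g : darc G -> darc H),
    [/\ bijective f, bijective g,
        forall e, dtail (g e) = f (dtail e)
      & forall e, dhead (g e) = f (dhead e)].

(* A walk is given by its sequence of arcs, so that parallel arcs give
   different walks. *)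
Fixpoint diwalk (G : digraph) (u : vertex G) (p : seq (darc G)) (v : vertex G)
    : bool :=
  if p is e :: p' then (dtail e == u) && diwalk (dhead e) p' v else u == v.

Definition dipath (G : digraph) (u : vertex G) (p : seq (darc G))
    (v : vertex G) : bool :=
  diwalk u p v && uniq (u :: [seq dhead e | e <- p]).

(* On a directed path these are all vertices except the two ends. *)
Definition inner_vertices (G : digraph) (p : seq (darc G)) : seq (vertex G) :=
  [seq dtail e | e <- behead p].

Definition strongly_connected (G : digraph) : Prop :=
  0 < #|vertex G| /\ forall u v : vertex G, exists p, dipath u p v.

Definition adjacent (G : digraph) (u v : vertex G) : bool :=
  [exists e : darc G, ((dtail e == u) && (dhead e == v))
                   || ((dtail e == v) && (dhead e == u))].

Definition semicomplete (s : nat) (G : digraph) : Prop :=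
  forall v : vertex G, #|[set w | (w != v) && ~~ adjacent v w]| <= s.

Record subdigraph (G : digraph) := Subdigraph {
  sverts : {set vertex G};
  sarcs : {set darc G};
  sarcs_closed : forall e, e \in sarcs ->
    (dtail e \in sverts) && (dhead e \in sverts) }.

Section SubdigraphAsDigraph.
Variables (G : digraph) (K : subdigraph G).

Definition sub_tail (e : {e : darc G | e \in sarcs K}) :
    {v : vertex G | v \in sverts K} :=
  Sub (dtail (val e)) (proj1 (andP (sarcs_closed (valP e)))).

Definition sub_head (e : {e : darc G | e \in sarcs K}) :
    {v : vertex G | v \in sverts K} :=
  Sub (dhead (val e)) (proj2 (andP (sarcs_closed (valP e)))).

Lemma sub_loopless e : sub_tail e != sub_head e.
Proof. by rewrite -val_eqE /= loopless. Qed.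

Definition digraph_of_sub : digraph := Digraph sub_loopless.

End SubdigraphAsDigraph.

Coercion digraph_of_sub : subdigraph >-> digraph.

Section DeleteVertices.
Variables (G : digraph) (X : {set vertex G}).

Definition del_arcs : {set darc G} :=
  [set e | (dtail e \notin X) && (dhead e \notin X)].

Lemma del_closed e : e \in del_arcs ->
  (dtail e \in ~: X) && (dhead e \in ~: X).
Proof. by rewrite !inE. Qed.

Definition delete_vertices : subdigraph G := Subdigraph del_closed.

End DeleteVertices.

(* All vertices of S are identified to the single new vertex None, and the arcs
   with both ends in S are deleted.  Only meaningful for nonempty S. *)
Section Contraction.
Variables (G : digraph) (S : {set vertex G}).

Definition contract_vertex (v : vertex G) : option {v : vertex G | v \notin S} :=
  insub v.

Definition contract_darc : finType :=
  {e : darc G | ~~ ((dtail e \in S) && (dhead e \in S))}.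

Definition contract_tail (e : contract_darc) := contract_vertex (dtail (val e)).
Definition contract_head (e : contract_darc) := contract_vertex (dhead (val e)).

Lemma contract_loopless e : contract_tail e != contract_head e.
Proof.
rewrite /contract_tail /contract_head /contract_vertex.
case: e => e /= He; apply/negP => /eqP.
case: insubP => [x _ Hx|Ht]; case: insubP => [y _ Hy|Hh] //.
  by case=> Exy; move: (loopless e); rewrite -Hx -Hy Exy eqxx.
by move: He Ht Hh; rewrite !negbK => /negP He Ht Hh; case: He; rewrite Ht Hh.
Qed.

Definition contract : digraph := Digraph contract_loopless.

End Contraction.

Definition contractible (G : digraph) (e : darc G) : Prop :=
  (forall e' : darc G, dhead e' = dhead e -> e' = e) \/
  (forall e' : darc G, dtail e' = dtail e -> e' = e).

Inductive butterfly_step (G : digraph) : digraph -> Prop :=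
  ButterflyStep (e : darc G) of contractible e :
    butterfly_step G (contract [set dtail e; dhead e]).

Inductive strong_step (G : digraph) : digraph -> Prop :=
  StrongStep (K : subdigraph G) of strongly_connected K :
    strong_step G (contract (sverts K)).

Definition minor_by (step : digraph -> digraph -> Prop) (H G : digraph) : Prop :=
  exists (K : subdigraph G) (D : digraph),
    clos_refl_trans_1n digraph step K D /\ digraph_iso D H.

Definition butterfly_minor : digraph -> digraph -> Prop :=
  minor_by butterfly_step.

Definition strong_minor : digraph -> digraph -> Prop := minor_by strong_step.

(* K is obtained from H by replacing every arc e by a directed path P e;
   phi embeds the original vertices. *)
Definition subdivision (H K : digraph) : Prop :=
  exists (phi : vertex H -> vertex K) (P : darc H -> seq (darc K)),
  [/\ injective phi,
      forall e, dipath (phi (dtail e)) (P e) (phi (dhead e)),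
      forall e v, phi v \notin inner_vertices (P e)
    & forall e e' x, x \in inner_vertices (P e) -> x \in inner_vertices (P e') ->
        e = e'] /\
  [/\ forall x, (exists v, x = phi v) \/ (exists e, x \in inner_vertices (P e))
    & forall a, exists! e, a \in P e].

Definition topological_minor (H G : digraph) : Prop :=
  exists K : subdigraph G, subdivision H K.

Definition minor_packing (minor : digraph -> digraph -> Prop) (H G : digraph)
    (k : nat) : Prop :=
  exists F : 'I_k -> subdigraph G,
    (forall i j, i != j -> [disjoint sverts (F i) & sverts (F j)]) /\
    (forall i, minor H (F i)).

Definition minor_cover (minor : digraph -> digraph -> Prop) (H G : digraph)
    (n : nat) : Prop :=
  exists X : {set vertex G}, #|X| <= n /\ ~ minor H (delete_vertices X).

(* Main.v *)
Require Import Defs.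
From mathcomp Require Import all_boot zify.
From Stdlib Require Import Classical ClassicalEpsilon Relation_Operators.

Set Implicit Arguments.
Unset Strict Implicit.
Unset Printing Implicit Defensive.

(** Order the vertices of an [s]-semicomplete digraph by out-degree. A vertex of
    larger out-degree reaches one of smaller out-degree by many paths of length
    two, and among many vertices of nearly equal out-degree most pairs are joined
    by such paths in both directions. Hence either there is a large "jungle", a set
    of vertices any two of which are joined by short paths that survive the deletion
    of any few vertices, or for every initial segment of the ordering the arcs
    leaving it upwards can be killed by deleting boundedly many vertices.

    A large jungle contains [k] disjoint models of [H], by greedy routing; for
    strong minors the routed paths close up a transitive chain into strong sets
    that are pairwise joined in both directions.

    If all these cuts are small, consider the intervals spanned by the strongly
    connected parts of the models of [H]. A family of unions of at most [d]
    intervals of a line has the Erdos-Posa property, so either [k] models span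
    disjoint sets, or boundedly many points meet the span of every model; deleting
    the cuts at these points then leaves no model, since a strongly connected part
    cannot straddle a cut. *)

(** * Piercing unions of intervals *)

(** The number [d] of intervals is where the hypothesis on [H] enters. A strong-minor model has one
    strongly connected branch set per vertex of [H], whatever [H] is, so [d] is the order of [H].
    Topological and butterfly models have no such parts in general, but for strongly connected [H] a
    model can be taken to be a single one, so [d = 1]. For topological minors this is immediate. For
    butterfly minors it is not: undoing a contraction can turn an end of the contracted arc into a
    source or a sink, and such an end has to be discarded before going further back. On the packing
    side, topological models found in a jungle serve butterfly minors as well. Iterated contraction
    produces nested types, so minors are handled through quotient maps onto a fixed target and
    through branch sets in the original digraph. *)

Lemma choice_fun (A B : Type) (P : A -> B -> Prop) :
  (forall x, exists y, P x y) -> exists f, forall x, P x (f x).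
Proof.
move=> h; exists (fun x => proj1_sig (constructive_indefinite_description _ (h x))).
by move=> x; apply: proj2_sig.
Qed.

Lemma ex_min (P : nat -> Prop) :
  (exists n, P n) -> exists n, P n /\ forall m, m < n -> ~ P m.
Proof.
case=> n; elim/ltn_ind: n => n IH Pn.
have [[m lt Pm]|h] := classic (exists2 m, m < n & P m); first exact: IH lt Pm.
by exists n; split=> // m lt Pm; apply: h; exists m.
Qed.

(** Double counting of the pairs of [r] inside [D]. *)
Lemma exists_small_indegree (T : finType) (r : rel T) (c : nat) (D : {set T}) :
  (forall x, x \in D -> #|[set y in D | r x y]| <= c) -> 0 < #|D| ->
  exists2 x, x \in D & #|[set y in D | r y x]| <= c.
Proof.
move=> hout D0; apply/exists_inP; apply: contraLR (leqnn (\sum_(x in D) c.+1)).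
rewrite negb_exists_in => /forall_inP hin; rewrite -ltnNge.
have cardE (q : pred T) : #|[set y in D | q y]| = \sum_(y in D) q y.
  rewrite -sum1_card big_mkcond [RHS]big_mkcond /=; apply: eq_bigr => y _.
  by rewrite inE; case: (y \in D); case: (q y).
have le1 : \sum_(x in D) c.+1 <= \sum_(x in D) \sum_(y in D) r y x.
  by apply: leq_sum => x xD; rewrite -cardE ltnNge hin.
apply: leq_ltn_trans le1 _; rewrite exchange_big /=.
apply: (@leq_ltn_trans (\sum_(x in D) c)).
  by apply: leq_sum => x xD; rewrite -cardE hout.
by rewrite !sum_nat_const ltn_pmul2l.
Qed.

(** Greedy choice: an element of in-degree at most [c] is selected and removed together with its at
    most [2 * c] neighbours; the out-degree bound passes to what remains. The relation need not be
    symmetric. *)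
Lemma exists_independent_set (T : finType) (r : rel T) (c k : nat) (D : {set T}) :
  (forall x, x \in D -> #|[set y in D | r x y]| <= c) ->
  k * (2 * c).+1 <= #|D| ->
  exists Y : {set T},
    [/\ Y \subset D, #|Y| = k & {in Y &, forall x y, x != y -> ~~ r x y}].
Proof.
elim: k D => [|k IH] D hout hD.
  by exists set0; rewrite sub0set cards0; split=> // x y; rewrite inE.
have [|x xD hin] := exists_small_indegree hout; first by lia.
pose N := x |: ([set y in D | r x y] :|: [set y in D | r y x]).
have cN : #|N| <= (2 * c).+1.
  rewrite cardsU1; have := leq_of_leqif (leq_card_setU [set y in D | r x y] [set y in D | r y x]).
  by have := hout x xD; case: (_ \notin _) => /=; lia.
have [||Y [YD cY hY]] := IH (D :\: N).
- move=> y /setDP[yD _]; apply: leq_trans (hout y yD); apply: subset_leq_card.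
  by apply/subsetP => z; rewrite !inE => /andP[/andP[_ ->] ->].
- by rewrite cardsD; have := subset_leq_card (subsetIr D N); lia.
have YN y : y \in Y -> [/\ y \in D, y != x, ~~ r x y & ~~ r y x].
  move/(subsetP YD); rewrite !inE !negb_or !negb_and => /andP[/and3P[-> h1 h2] yD].
  by move: h1 h2; rewrite yD.
exists (x |: Y); split.
- by rewrite subUset sub1set xD; apply/subsetP => y /YN[].
- by rewrite cardsU1 cY; case: (boolP (x \in Y)) => // /YN[_]; rewrite eqxx.
- move=> y z; rewrite !inE => /predU1P[->|yY] /predU1P[->|zY]; rewrite ?eqxx //.
  + by case/YN: zY.
  + by case/YN: yY.
  + exact: hY.
Qed.

Definition in_itv (x : nat) (I : nat * nat) := I.1 <= x <= I.2.
Definition covers (x : nat) (A : seq (nat * nat)) := has (in_itv x) A.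
Definition apart (A B : seq (nat * nat)) := forall x, ~~ (covers x A && covers x B).

(** The smaller right end of two meeting intervals lies in both. This orients the meeting relation
    so that out-degrees are controlled by the number of right ends. *)
Lemma meet_right_end A B x : covers x A -> covers x B ->
  has (fun I => covers I.2 B) A || has (fun I => covers I.2 A) B.
Proof.
move=> /hasP[[a b] IA /andP[/= ax xb]] /hasP[[a' b'] IB /andP[/= ax' xb']].
case: (leqP b b') => h; apply/orP; [left|right]; apply/hasP.
  by exists (a, b) => //; apply/hasP; exists (a', b') => //; rewrite /in_itv /=; lia.
by exists (a', b') => //; apply/hasP; exists (a, b) => //; rewrite /in_itv /=; lia.
Qed.

(** Each of the [d] right ends of a member lies in at most [c] members, so [r] below has out-degrees
    at most [d * c]; independence for [r] means being apart, by [meet_right_end]. *)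
Lemma thin_family_packing (T : finType) (A : T -> seq (nat * nat)) (d c k : nat) :
  (forall t, size (A t) = d) ->
  (forall x, #|[set t | covers x (A t)]| <= c) ->
  k * (2 * (d * c)).+1 <= #|T| ->
  exists Y : {set T}, #|Y| = k /\ {in Y &, forall s t, s != t -> apart (A s) (A t)}.
Proof.
move=> szA thin big.
pose r s t := has (fun I => covers I.2 (A t)) (A s).
have [t _||Y [_ cY hY]] := @exists_independent_set T r (d * c) k setT.
- rewrite /r -(szA t); elim: (A t) => [|I l IH] /=.
    by rewrite mul0n leqn0 cards_eq0; apply/eqP/setP => y; rewrite !inE.
  rewrite mulSn; apply: leq_trans (leq_add (thin I.2) IH).
  apply: leq_trans (leq_card_setU _ _); apply: subset_leq_card.
  by apply/subsetP => y; rewrite !inE.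
- by rewrite cardsT.
exists Y; split=> // s t sY tY st x; apply/negP => /andP[xs xt].
have:= meet_right_end xs xt; rewrite -/(r s t) -/(r t s).
by rewrite (negPf (hY _ _ sY tY st)) (negPf (hY _ _ tY sY _)) 1?eq_sym.
Qed.

Definition itv_packing (P : seq (nat * nat) -> Prop) (k : nat) :=
  exists A : nat -> seq (nat * nat),
    (forall i, i < k -> P (A i)) /\
    (forall i j, i < k -> j < k -> i != j -> apart (A i) (A j)).

Definition itv_cover (P : seq (nat * nat) -> Prop) (t : nat) :=
  exists ps : seq nat, size ps <= t /\ forall A, P A -> has (covers^~ A) ps.

Definition itv_family (d : nat) (P : seq (nat * nat) -> Prop) :=
  forall A, P A -> size A = d /\ all (fun I => I.1 <= I.2) A.

Definition rests (P : seq (nat * nat) -> Prop) (q q' : nat) (B : seq (nat * nat)) :=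
  exists I, [/\ P (I :: B), q <= I.1 & I.2 <= q'].

Lemma itv_cover_cat (P Q R : seq (nat * nat) -> Prop) (t u : nat) :
  itv_cover P t -> itv_cover Q u -> (forall A, R A -> P A \/ Q A) ->
  itv_cover R (t + u).
Proof.
move=> [ps [st hP]] [qs [su hQ]] hR; exists (ps ++ qs); split.
  by rewrite size_cat leq_add.
by move=> A /hR[/hP|/hQ]; rewrite has_cat => ->; rewrite ?orbT.
Qed.

(** A block is the shortest stretch from [q] whose remainders contain [N] pairwise disjoint ones. By
    minimality of its end [q'], the members whose first interval ends before [q'] cost [T] points;
    those whose first interval contains [q'] cost one; the others are left to the search from
    [q'.+1]. *)
Lemma itv_blocks (P : seq (nat * nat) -> Prop) (d N T R q : nat) :
  itv_family d.+1 P ->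
  (forall Q, itv_family d Q -> itv_packing Q N \/ itv_cover Q T) ->
  (exists J : nat -> nat * nat,
     [/\ forall r, r < R -> q <= (J r).1 <= (J r).2,
         forall r r', r' < R -> r < r' -> (J r).2 < (J r').1
       & forall r, r < R -> itv_packing (rests P (J r).1 (J r).2) N]) \/
  itv_cover (fun A => P A /\ q <= (head (0, 0) A).1) (R * T.+1).
Proof.
move=> famP IHd; elim: R q => [|R IH] q.
  by left; exists (fun=> (0, 0)).
have famQ Q : (forall B, Q B -> exists I, P (I :: B)) -> itv_family d Q.
  by move=> h B /h[I /famP[[sz] /= /andP[]]].
have [exq|noq] := classic (exists q', q <= q' /\ itv_packing (rests P q q') N); last first.
  right; case: (IHd (fun B => exists I, P (I :: B) /\ q <= I.1)).
  - by apply: famQ => B [I []]; exists I.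
  - move=> [B [hB apB]]; case: noq.
    have [I hI] : exists I, forall i, i < N -> P (I i :: B i) /\ q <= (I i).1.
      apply: (choice_fun (P := fun i I => i < N -> P (I :: B i) /\ q <= I.1)) => i.
      by case: (ltnP i N) => [/hB[I hI]|_]; [exists I | exists (0, 0)].
    (* An end beyond all [N] first intervals would be admissible, against [noq]. *)
    exists (q + \max_(i < N) (I i).2); split; first by lia.
    exists B; split=> // i iN; exists (I i); case: (hI i iN) => PI qI; split=> //.
    by have := @leq_bigmax _ (fun i : 'I_N => (I i).2) (Ordinal iN); simpl; lia.
  - move=> [ps [sz hps]]; exists ps; split; first by lia.
    move=> [|I B] [PA /= qA]; first by case: (famP _ PA).
    have /hps : exists I, P (I :: B) /\ q <= I.1 by exists I.
    by apply: sub_has => x; rewrite /covers /= => ->; rewrite orbT.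
have [q' [[qq' pq'] minq']] := ex_min exq.
case: (IH q'.+1) => [[J [J1 J2 J3]]|cov]; [left|right].
  exists (fun r => if r is r'.+1 then J r' else (q, q')); split.
  - by case=> [|r] //= lt; [lia | have := J1 r lt; lia].
  - by case=> [|r] [|r'] //= lt lt' //; [have := J1 r' lt; lia | apply: J2; lia].
  - by case=> [|r] //=; apply: J3.
have covT : itv_cover (fun A => P A /\ (q <= (head (0,0) A).1 /\ (head (0,0) A).2 < q')) T.
  case: (ltnP q q') => lt; last first.
    exists [::]; split=> // [[|I B]] [PA /= [h1 h2]]; first by case: (famP _ PA).
    by case: (famP _ PA) => _ /= /andP[]; lia.
  case: (IHd (rests P q q'.-1)).
  - by apply: famQ => B [I []]; exists I.
  - by move=> pk; case: (minq' q'.-1); [lia | split=> //; lia].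
  - move=> [ps [sz hps]]; exists ps; split=> // [[|I B]] [PA /= [h1 h2]].
      by case: (famP _ PA).
    have /hps : rests P q q'.-1 B by exists I; split=> //; lia.
    by apply: sub_has => x; rewrite /covers /= => ->; rewrite orbT.
have cov1 : itv_cover (fun A => P A /\ ((head (0,0) A).1 <= q' <= (head (0,0) A).2)) 1.
  exists [:: q']; split=> // [[|I B]] [PA /= h]; first by case: (famP _ PA).
  by rewrite /covers /= /in_itv h.
rewrite (_ : R.+1 * T.+1 = 1 + T + R * T.+1); last by lia.
apply: (itv_cover_cat (itv_cover_cat cov1 covT (fun A h => h)) cov) => A [PA qA].
case: (ltnP q' (head (0,0) A).1) => h1; first by right.
by left; case: (ltnP (head (0,0) A).2 q') => h2; [right | left]; split=> //; apply/andP.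
Qed.

(* Blocks of the line are chosen so that each carries [N] members with their
   first interval in the block and pairwise disjoint remainders; enlarging the
   first interval to the whole block, every point is then covered at most [2 * N]
   times by the [N * N] resulting members. *)
Theorem itv_packing_or_cover (d k : nat) :
  exists t, forall P, itv_family d P -> itv_packing P k \/ itv_cover P t.
Proof.
elim: d k => [|d IH] k.
  exists 0 => P famP; have [[A PA]|noA] := classic (exists A, P A).
    left; exists (fun=> A); split=> // i j _ _ _ x.
    by case: (famP A PA) => /size0nil ->.
  by right; exists [::]; split=> // A PA; case: noA; exists A.
(* Chosen so that [k * (2 * (d.+1 * (2 * N))).+1 <= N * N], the size condition of
   [thin_family_packing]. *)
pose N := k * (4 * d.+1).+1; have [T hT] := IH N.
exists (N * T.+1) => P famP.
case: (itv_blocks N 0 famP hT) => [[J [J1 J2 J3]]|[ps [sz hps]]]; last first.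
  by right; exists ps; split=> // A PA; apply: hps.
left.
have [B hB] := choice_fun (fun r : 'I_N => J3 r (ltn_ord r)).
pose A (u : 'I_N * 'I_N) := J u.1 :: B u.1 u.2.
have [I hI] := choice_fun (fun u : 'I_N * 'I_N => (hB u.1).1 u.2 (ltn_ord u.2)).
have [u|x||Y [cY hY]] := @thin_family_packing _ A d.+1 (2 * N) k.
- by case: (hI u) => /famP[] /= -[<-].
- rewrite mul2n -addnn.
  (* A point lies in at most one block, which fixes the first coordinate; in [le2] the remainders
     within a block are apart, so the block fixes the second. *)
  have le1 : #|[set u : 'I_N * 'I_N | in_itv x (J u.1)]| <= N.
    rewrite -[N in _ <= N]card_ord; rewrite -(card_in_imset (f := snd)) ?max_card //.
    move=> [r i] [r' i']; rewrite !inE /= => /andP[h1 h2] /andP[h1' h2'] /= ->.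
    congr (_, _); apply/val_inj; move: (J2 r r' (ltn_ord _)) (J2 r' r (ltn_ord _)) => /=.
    by case: (ltngtP r r') => //; lia.
  have le2 : #|[set u : 'I_N * 'I_N | covers x (B u.1 u.2)]| <= N.
    rewrite -[N in _ <= N]card_ord; rewrite -(card_in_imset (f := fst)) ?max_card //.
    move=> [r i] [r' i']; rewrite !inE /= => h1 h2 Er; subst r'.
    congr (_, _); apply/eqP/negPn/negP => ne.
    case: (hB r) => _ /(_ i i' (ltn_ord _) (ltn_ord _) ne x).
    by rewrite h1 h2.
  apply: leq_trans (leq_add le1 le2); apply: leq_trans (leq_card_setU _ _).
  by apply: subset_leq_card; apply/subsetP => u; rewrite !inE.
- by rewrite card_prod !card_ord /N; nia.
exists (fun i => if insub i is Some j then let u := enum_val (cast_ord (esym cY) j) in I u :: B u.1 u.2 else [::]).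
split=> [i ik|i j ik jk ij x]; first by rewrite insubT; case: (hI (enum_val (cast_ord (esym cY) (Ordinal ik)))).
rewrite !insubT /=; set u := enum_val _; set v := enum_val _.
have uv : u != v.
  by apply/eqP => /enum_val_inj /cast_ord_inj []; apply/eqP.
have := hY u v (enum_valP _) (enum_valP _) uv x; apply: contraNN.
rewrite /A /covers /=.
have sub w : in_itv x (I w) -> in_itv x (J w.1).
  by case: (hI w) => _; rewrite /in_itv; lia.
by case/andP => /orP[/sub->|->] /orP[/sub->|->]; rewrite ?orbT.
Qed.

(** * Out-degree orderings and jungles *)

Lemma card_setU_le (T : finType) (A B : {set T}) : #|A :|: B| <= #|A| + #|B|.
Proof. exact: leq_of_leqif (leq_card_setU A B). Qed.

Lemma exists_outside (T : finType) (A B : {set T}) :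
  #|B| < #|A| -> exists2 x, x \in A & x \notin B.
Proof.
move=> lt; apply/exists_inP; apply: contraLR lt.
rewrite negb_exists_in -leqNgt => /forall_inP h; apply: subset_leq_card.
by apply/subsetP => x /h /negPn.
Qed.

Lemma card_flatten_le (T : finType) (Q : eqType) (p : Q -> seq T) (l : seq Q) c :
  {in l, forall q, size (p q) <= c} ->
  #|[set x in flatten [seq p q | q <- l]]| <= c * size l.
Proof.
move=> h; rewrite cardsE; apply: leq_trans (card_size _) _.
elim: l h => //= q l IH h; rewrite size_cat mulnS leq_add //.
  by apply: h; rewrite mem_head.
by apply: IH => q' q'l; apply: h; rewrite inE q'l orbT.
Qed.

Section Semicomplete.

Variables (V : finType) (a : rel V) (s : nat).
Hypothesis a_irr : irreflexive a.
Hypothesis a_semi : forall v, #|[set w | (w != v) && ~~ (a v w || a w v)]| <= s.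

Definition outs v := [set w | a v w].
Definition mids v w := [set x | a v x && a x w].

(** An out-neighbour of [v] to which [w] sends no arc either sends one to [w], or is [w], or is one
    of the at most [s] non-neighbours of [w]. *)
Lemma outs_diff v w : #|outs v :\: outs w| <= #|mids v w| + s.+1.
Proof.
have sub : outs v :\: outs w \subset
    mids v w :|: (w |: [set x | (x != w) && ~~ (a w x || a x w)]).
  apply/subsetP => x; rewrite !inE => /andP[/negPf -> ->] /=.
  by case: (a x w) => //=; case: (x == w).
apply: leq_trans (subset_leq_card sub) _; apply: leq_trans (card_setU_le _ _) _.
rewrite leq_add2l; apply: leq_trans (card_setU_le _ _) _.
by rewrite cards1 add1n ltnS a_semi.
Qed.

Lemma outs_le v w : #|outs v| <= #|outs w| + #|mids v w| + s.+1.
Proof.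
have := outs_diff v w; rewrite cardsD.
by have := subset_leq_card (subsetIr (outs v) (outs w)); lia.
Qed.

(** Only the interior [p] must avoid [F]; the ends may belong to it. Four is the interior length of
    the paths in [jungle_or_cuts]. A nonempty interior ensures that internally disjoint paths share
    no arc, even between the same ends. *)
Definition robust m y z := forall F : {set V}, #|F| <= m -> exists p : seq V,
  [/\ path a y (rcons p z), uniq (y :: rcons p z), 0 < size p <= 4
    & all (fun x => x \notin F) p].

Definition jungle m (Y : {set V}) := {in Y &, forall y z, y != z -> robust m y z}.

Lemma robust_mids m y z : y != z -> m < #|mids y z| -> robust m y z.
Proof.
move=> yz lt F cF; have [x] := exists_outside (leq_ltn_trans cF lt).
rewrite inE => /andP[yx xz] xF; exists [:: x]; split=> //=; rewrite ?yx ?xz ?xF //.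
rewrite !inE negb_or yz !andbT /=; apply/andP; split.
  by apply: contraTneq yx => ->; rewrite a_irr.
by apply: contraTneq xz => ->; rewrite a_irr.
Qed.

(** An independent set of [s.+2] vertices would give each of them [s.+1] non-neighbours, since [r]
    sees every arc in one direction or the other. *)
Lemma sparse_small (r : rel V) c (W : {set V}) :
  (forall x y, a x y -> r x y || r y x) ->
  (forall x, x \in W -> #|[set y in W | r x y]| <= c) ->
  #|W| < s.+2 * (2 * c).+1.
Proof.
move=> ar rc; rewrite ltnNge; apply/negP => /(exists_independent_set rc)[Y [_ cY hY]].
have /card_gt0P[x xY] : 0 < #|Y| by rewrite cY.
have := a_semi x; rewrite leqNgt => /negP; apply.
have -> : s.+1 = #|Y :\ x| by move: cY; rewrite (cardsD1 x) xY add1n => -[].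
apply: subset_leq_card; apply/subsetP => y; rewrite !inE => /andP[yx yY].
rewrite yx /=; apply/negP => /orP[] /ar.
  by rewrite (negPf (hY x y _ _ _)) ?(negPf (hY y x _ _ _)) // eq_sym.
by rewrite (negPf (hY x y _ _ _)) ?(negPf (hY y x _ _ _)) // eq_sym.
Qed.

(** The two summands are the [sparse_small] bounds inside and outside [outs v] in [few_bad]. *)
Definition tangle_const l m :=
  s.+2 * (2 * m).+1 + s.+2 * (2 * (l + m + s.+1)).+1.

(* A vertex [w] reached from [v] by few paths of length two has few in-neighbours
   in [outs v] and few out-neighbours outside it, so both the vertices of this kind
   inside [outs v] and those outside it induce sparse digraphs. *)
Lemma few_bad l m (D : {set V}) v :
  {in D &, forall x y, #|outs x| <= #|outs y| + l} -> v \in D ->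
  #|[set w in D | #|mids v w| <= m]| <= tangle_const l m.
Proof.
move=> spread vD; set W := [set w in D | _].
have h1 : #|W :&: outs v| < s.+2 * (2 * m).+1.
  apply: (@sparse_small (fun x y => a y x)) => [x y -> |w]; first by rewrite orbT.
  rewrite !inE => /andP[/andP[_ wm] vw]; apply: leq_trans wm.
  by apply: subset_leq_card; apply/subsetP => x; rewrite !inE => /andP[/andP[_ ->] ->].
have h2 : #|W :\: outs v| < s.+2 * (2 * (l + m + s.+1)).+1.
  apply: (@sparse_small a) => [x y -> //|w].
  rewrite !inE => /andP[vw /andP[wD wm]].
  apply: (@leq_trans #|outs w :\: outs v|).
    by apply: subset_leq_card; apply/subsetP => x; rewrite !inE => /andP[/andP[-> _] ->].
  (* Nearly equal out-degrees allow the two differences of out-neighbourhoods to be exchanged at the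
     cost of [l]. *)
  have := outs_diff v w; have := spread w v wD vD.
  rewrite !cardsD setIC.
  by have := subset_leq_card (subsetIr (outs v) (outs w)); lia.
by rewrite -(cardsID (outs v) W) /tangle_const leq_add // ltnW.
Qed.

Lemma tangle_jungle l m N (D : {set V}) :
  {in D &, forall x y, #|outs x| <= #|outs y| + l} ->
  N * (2 * tangle_const l m).+1 <= #|D| ->
  exists Y : {set V}, #|Y| = N /\ jungle m Y.
Proof.
move=> spread big.
have [Y [YD cY hY]] := exists_independent_set (fun v vD => few_bad m spread vD) big.
exists Y; split=> // y z yY zY yz; apply: robust_mids => //.
by rewrite ltnNge hY.
Qed.

Definition by_outs := sort (fun x y => #|outs x| <= #|outs y|) (enum V).
Definition pos v := index v by_outs.

Lemma mem_by_outs v : v \in by_outs.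
Proof. by rewrite mem_sort mem_enum. Qed.

Lemma pos_inj : injective pos.
Proof. by move=> x y; apply: (index_inj x); apply: mem_by_outs. Qed.

Lemma pos_outs x y : pos x <= pos y -> #|outs x| <= #|outs y|.
Proof.
apply: (@sorted_leq_index _ (fun x y => #|outs x| <= #|outs y|)); try exact: mem_by_outs.
- by move=> u v w; apply: leq_trans.
- by move=> u.
- by apply: sort_sorted => u v; apply: leq_total.
Qed.

Lemma size_by_outs : size by_outs = #|V|.
Proof. by rewrite size_sort cardE. Qed.

Lemma pos_lt v : pos v < #|V|.
Proof. by rewrite -size_by_outs index_mem mem_by_outs. Qed.

Definition window i j := [set v | i <= pos v < j].

Lemma window_le i j : #|window i j| <= j - i.
Proof.
rewrite cardE -(size_iota i (j - i)) -(size_map pos).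
apply: uniq_leq_size; first by rewrite (map_inj_uniq pos_inj) enum_uniq.
by move=> k /mapP[v + ->]; rewrite mem_enum inE mem_iota; lia.
Qed.

Lemma window_ge i j : j <= #|V| -> j - i <= #|window i j|.
Proof.
move=> jV; have sV := size_by_outs.
case: (leqP j i) => [|ij]; first by move/eqP ->.
have /card_gt0P[v0 _] : 0 < #|V| by lia.
have nthE k : k < j -> pos (nth v0 by_outs k) = k.
  move=> kj; rewrite /pos index_uniq ?sort_uniq ?enum_uniq // sV; exact: leq_trans jV.
rewrite cardE -(size_iota i (j - i)) -(size_map (nth v0 by_outs)).
apply: uniq_leq_size.
  rewrite map_inj_in_uniq ?iota_uniq // => k k'; rewrite !mem_iota => h h' /(congr1 pos).
  by rewrite !nthE; lia.
by move=> v /mapP[k + ->]; rewrite mem_iota mem_enum inE => h; rewrite nthE; lia.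
Qed.

(** The size of the window around the cut in [jungle_or_cuts], plus the [m] vertices that a robust
    path has to avoid. *)
Definition cut_width m N :=
  N + 2 * (N * (2 * tangle_const (m + s + 4) m).+1) + m.

(* Paths [y -> u -> x -> z -> u' -> y'] through an arc [x -> z] going up in the
   ordering by out-degree; the other steps are down and therefore abundant. *)
Lemma jungle_or_cuts m N :
  (exists Y : {set V}, #|Y| = N /\ jungle m Y) \/
  (forall i, exists Z : {set V}, #|Z| <= cut_width m N /\
     forall x y, a x y -> pos x < i -> i <= pos y -> (x \in Z) || (y \in Z)).
Proof.
have [|noY] := classic (exists Y : {set V}, #|Y| = N /\ jungle m Y); [by left | right].
move=> i; apply: NNPP => noZ; apply: noY.
(* The slack [m + s + 4] leaves, after the loss of [s.+1] in [outs_le], at least [m + 4] midpoints: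
   enough to avoid [F] and the at most three further vertices excluded below. *)
set K := N * (2 * tangle_const (m + s + 4) m).+1.
have [[D [spread big]]|noD] := classic (exists D : {set V},
    {in D &, forall x y, #|outs x| <= #|outs y| + (m + s + 4)} /\ K <= #|D|).
  exact: tangle_jungle spread big.
(* Otherwise the vertices from [x] to [y] in the ordering have nearly equal out-degrees, against
   [noD]. *)
have gap x y : pos x + K <= pos y -> #|outs x| + (m + s + 4) < #|outs y|.
  move=> xy; rewrite ltnNge; apply/negP => le; apply: noD.
  exists (window (pos x) (pos y).+1); split; last first.
    by apply: leq_trans (window_ge _ (pos_lt y)); lia.
  move=> u v; rewrite !inE => /andP[_ uy] /andP[xv _].
  rewrite ltnS in uy.
  by have := pos_outs uy; have := pos_outs xv; lia.
have arc (Z : {set V}) : #|Z| <= cut_width m N -> exists x y,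
    [/\ a x y, pos x < i <= pos y, x \notin Z & y \notin Z].
  move=> cZ; apply: NNPP => h; apply: noZ; exists Z; split=> // x y xy xi yi.
  apply/negPn/negP; rewrite negb_or => /andP[xZ yZ]; apply: h.
  by exists x, y; rewrite xi yi.
(* An upward arc avoiding [Win] starts more than [K] positions below each of the [N] vertices just
   before [i] and ends more than [K] above, so [gap] applies at both ends. *)
pose Win := window (i - (N + K)) (i + K).
have cWin : #|Win| <= N + 2 * K by apply: leq_trans (window_le _ _) _; lia.
(* The mere existence of such an arc shows that all positions from [i - N] to [i.-1] are
   occupied. *)
have iNK : N + K <= i <= #|V|.
  have [|x [y [_ xy]]] := arc Win; first by rewrite /cut_width -/K; lia.
  by rewrite !inE; have := pos_lt y; lia.
exists (window (i - N) i); split.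
  by apply/eqP; rewrite eqn_leq (leq_trans (window_le _ _)) ?(leq_trans _ (window_ge _ _)); lia.
move=> y y'; rewrite !inE => yi yi' yy' F cF.
have [|x [z [xz xzi]]] := arc (Win :|: F).
  by apply: leq_trans (card_setU_le _ _) _; rewrite /cut_width -/K; lia.
rewrite !inE !negb_or => /andP[xW xF] /andP[zW zF].
have posN u v : pos u != pos v -> u != v by apply: contraNneq => ->.
have far v : i - N <= pos v < i -> (v != x) * (v != z) * (x != v) * (z != v).
  move=> vi; rewrite ![_ == v]eq_sym.
  have -> : v != x by apply: posN; clear - vi xW xzi iNK; lia.
  by have -> : v != z by apply: posN; clear - vi zW xzi iNK; lia.
have ux := gap x y; have zy := gap z y'; have ly := outs_le y x; have ly' := outs_le z y'.
have zy' := gap y' z.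
have [|u] := @exists_outside _ (mids y x) (F :|: [set y'; z]).
  apply: leq_ltn_trans (card_setU_le _ _) _; have := cards2 y' z; case: (_ == _) => /=; lia.
rewrite !inE !negb_or => /andP[yu ux'] /and3P[uF uy' uz].
have [|u'] := @exists_outside _ (mids z y') (F :|: (u |: [set y; x])).
  apply: leq_ltn_trans (card_setU_le _ _) _.
  have := card_setU_le [set u] [set y; x]; rewrite cards1 cards2.
  by case: (_ == _) => /=; lia.
rewrite !inE !negb_or => /andP[zu' u'y'] /and4P[u'F u'u u'y u'x].
exists [:: u; x; z; u']; split=> //=.
- by rewrite yu ux' xz zu' u'y'.
- have ne v w : a v w -> v != w by apply: contraTneq => ->; rewrite a_irr.
  rewrite !inE !negb_or yy' (ne _ _ yu) (ne _ _ ux') uz uy' (ne _ _ xz) (ne _ _ zu') (ne _ _ u'y').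
  rewrite ![_ == u']eq_sym u'u u'y u'x /= !andbT.
  by rewrite !far.
- by rewrite uF xF zF u'F.
Qed.

(** * Transitive chains and disjoint routing *)

Fixpoint chain_const n := if n is n'.+1 then 2 * chain_const n' + s.+2 else 0.

(** All but [s.+1] vertices, counting [v] itself, are out- or in-neighbours of [v], so one side is
    large; [v] is put in front of, or behind, the chain found there. *)
Lemma exists_chain n (Y : {set V}) : chain_const n <= #|Y| ->
  exists t : seq V, [/\ size t = n, uniq t, {subset t <= Y} & pairwise a t].
Proof.
elim: n Y => [|n IH] Y /= big; first by exists [::].
have /card_gt0P[v vY] : 0 < #|Y| by lia.
have sub : Y \subset (v |: [set w | (w != v) && ~~ (a v w || a w v)]) :|:
    ((Y :&: outs v) :|: [set w in Y | a w v]).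
  apply/subsetP => w wY; rewrite !inE wY /=.
  by case: (w == v) => //=; case: (a v w); case: (a w v).
have := subset_leq_card sub; have := a_semi v.
have := card_setU_le (v |: [set w | (w != v) && ~~ (a v w || a w v)])
          ((Y :&: outs v) :|: [set w in Y | a w v]).
have := card_setU_le [set v] [set w | (w != v) && ~~ (a v w || a w v)].
have := card_setU_le (Y :&: outs v) [set w in Y | a w v]; rewrite cards1 => h1 h2 h3 h4 h5.
case: (leqP (chain_const n) #|Y :&: outs v|) => [/IH|lt].
  move=> [t [st ut tY pt]]; exists (v :: t); split=> /=.
  - by rewrite st.
  - by rewrite ut andbT; apply/negP => /tY; rewrite !inE a_irr andbF.
  - by move=> x; rewrite inE => /predU1P[->|/tY]//; rewrite !inE => /andP[].
  - by rewrite pt andbT; apply/allP => x /tY; rewrite !inE => /andP[].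
have /IH [t [st ut tY pt]] : chain_const n <= #|[set w in Y | a w v]| by lia.
exists (rcons t v); split.
- by rewrite size_rcons st.
- by rewrite rcons_uniq ut andbT; apply/negP => /tY; rewrite !inE a_irr andbF.
- by move=> x; rewrite mem_rcons inE => /predU1P[->|/tY]//; rewrite !inE => /andP[].
- rewrite pairwise_rcons pt andbT; apply/allP => x /tY; by rewrite !inE => /andP[].
Qed.

(** Greedy routing: a new path avoids [F0] and the at most four inner vertices of each earlier path.
    Callers put the ends into [F0] to keep the interiors off them. *)
Lemma linkage m (Y F0 : {set V}) (Q : finType) (src dst : Q -> V) :
  jungle m Y -> #|F0| + 4 * #|Q| <= m ->
  (forall q, [/\ src q \in Y, dst q \in Y & src q != dst q]) ->
  exists p : Q -> seq V,
    (forall q, [/\ path a (src q) (rcons (p q) (dst q)),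
                   uniq (src q :: rcons (p q) (dst q)), 0 < size (p q) <= 4
                 & all (fun x => x \notin F0) (p q)]) /\
    (forall q q' x, x \in p q -> x \in p q' -> q = q').
Proof.
move=> jY big hq.
suff [p [hp dp]] : exists p : Q -> seq V,
    (forall q, q \in enum Q -> [/\ path a (src q) (rcons (p q) (dst q)),
                   uniq (src q :: rcons (p q) (dst q)), 0 < size (p q) <= 4
                 & all (fun x => x \notin F0) (p q)]) /\
    (forall q q' x, q \in enum Q -> q' \in enum Q -> x \in p q -> x \in p q' -> q = q').
  exists p; split=> [q|q q' x]; first by apply: hp; rewrite mem_enum.
  by apply: dp; rewrite mem_enum.
have : size (enum Q) <= #|Q| by rewrite cardE.
elim: (enum Q) => [|q l IH] szl; first by exists (fun=> [::]).
have [|p [hp dp]] := IH; first exact: ltnW.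
pose F := F0 :|: [set x in flatten [seq p q' | q' <- l]].
have cF : #|F| <= m.
  apply: leq_trans (card_setU_le _ _) _.
  suff : #|[set x in flatten [seq p q' | q' <- l]]| <= 4 * size l by move: szl big => /=; lia.
  by apply: card_flatten_le => q' /hp[_ _ /andP[]].
case: (hq q) => sY dY sd; case: (jY _ _ sY dY sd F cF) => pq [h1 h2 h3 h4].
case: (boolP (q \in l)) => ql.
  exists p; split=> [q'|q' q'' x]; rewrite !inE.
    by case/predU1P => [->|]; apply: hp.
  by case/predU1P => [->|?]; case/predU1P => [->|?] //; apply: dp.
have Fl q' x : q' \in l -> x \in p q' -> x \in F.
  move=> q'l xp; rewrite !inE; apply/orP; right; apply/flatten_mapP; by exists q'.
exists (fun q' => if q' == q then pq else p q'); split.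
  move=> q'; rewrite inE; case: eqP => [-> _|_ /= /hp //]; split=> //.
  by apply: sub_all h4 => x; rewrite inE negb_or => /andP[].
move=> q' q'' x; rewrite !inE; case: eqP => [-> _|_ /= q'l]; case: eqP => [-> _|_ /= q''l] //.
- by move=> /(allP h4) /negP xF /(Fl _ _ q''l).
- by move=> /(Fl _ _ q'l) xF /(allP h4) /negP.
- exact: dp.
Qed.

End Semicomplete.

(** * Quotients and strong minors *)

Definition arc (G : digraph) : rel (vertex G) :=
  fun x y => [exists e : darc G, (dtail e == x) && (dhead e == y)].

Lemma arcP (G : digraph) (x y : vertex G) :
  reflect (exists2 e : darc G, dtail e = x & dhead e = y) (arc x y).
Proof.
apply: (iffP existsP) => [[e /andP[/eqP h1 /eqP h2]]|[e <- <-]]; exists e => //.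
by rewrite !eqxx.
Qed.

Arguments arcP {G x y}.

Lemma arc_dart (G : digraph) (e : darc G) : arc (dtail e) (dhead e).
Proof. by apply/arcP; exists e. Qed.

Lemma arc_irr (G : digraph) : irreflexive (@arc G).
Proof.
by move=> x; apply/arcP => -[e h1 h2]; have := loopless e; rewrite h1 h2 eqxx.
Qed.

Lemma adjacentE (G : digraph) (x y : vertex G) : adjacent x y = arc x y || arc y x.
Proof.
apply/existsP/orP => [[e /orP[]/andP[/eqP<- /eqP<-]]|[]/arcP[e <- <-]].
- by left; apply: arc_dart.
- by right; apply: arc_dart.
- by exists e; rewrite !eqxx.
- by exists e; rewrite !eqxx orbT.
Qed.

Lemma connect_map (T T' : finType) (e : rel T) (e' : rel T') (f : T -> T') :
  (forall x y, e x y -> connect e' (f x) (f y)) ->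
  forall x y, connect e x y -> connect e' (f x) (f y).
Proof.
move=> h x y /connectP[p]; elim: p x => [|z p IH] x /=; first by move=> _ ->.
by move=> /andP[/h xz pz] ly; apply: connect_trans xz (IH z pz ly).
Qed.

(** A path lifts arc by arc, and consecutive lifted arcs are joined inside a fibre. [Q] confines the
    lift to a part of the digraph. *)
Lemma connect_lift (T T' : finType) (e : rel T) (e' : rel T') (pi : T -> T')
    (Q : pred T) :
  (forall x y, Q x -> Q y -> pi x = pi y -> connect e x y) ->
  (forall X Y, e' X Y -> exists x y, [/\ Q x, Q y, pi x = X, pi y = Y & e x y]) ->
  forall x y, Q x -> Q y -> connect e' (pi x) (pi y) -> connect e x y.
Proof.
move=> fib lift x y Qx Qy /connectP[p].
elim: p x Qx => [|Z p IH] x Qx /=; first by move=> _ /esym; apply: fib.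
move=> /andP[/lift[u [v [Qu Qv pu pv uv]]] pZ] ly.
apply: connect_trans (fib x u Qx Qu (esym pu)) _.
by apply: connect_trans (connect1 uv) (IH v Qv _ _); rewrite pv.
Qed.

Lemma dipath_of_path (G : digraph) (u : vertex G) p :
  path (@arc G) u p -> uniq (u :: p) ->
  exists q, dipath u q (last u p) /\ map (@dhead G) q = p.
Proof.
move=> pth un; suff [q [wq hq]] : exists q, diwalk u q (last u p) /\ map (@dhead G) q = p.
  by exists q; rewrite /dipath wq hq.
elim: p u pth {un} => [|x p IH] u /=; first by exists [::]; rewrite /= eqxx.
move=> /andP[/arcP[e eu ex] /IH[q [wq hq]]]; exists (e :: q).
by rewrite /= eu ex eqxx hq.
Qed.

Lemma connect_diwalk (G : digraph) (u v : vertex G) q : diwalk u q v -> connect (@arc G) u v.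
Proof.
elim: q u => [|e q IH] u /=; first by move/eqP->.
by move=> /andP[/eqP <- /IH]; apply: connect_trans; apply: connect1; apply: arc_dart.
Qed.

Lemma stronglyP (G : digraph) :
  strongly_connected G <-> 0 < #|vertex G| /\ forall u v, connect (@arc G) u v.
Proof.
split=> -[G0 h]; split=> // u v.
  by case: (h u v) => p /andP[/connect_diwalk].
case/connectP: (h u v) => p pth ->; case: (shortenP pth) => p' pth' un' _.
by case: (dipath_of_path pth' un') => q [hq _]; exists q.
Qed.

Lemma bij_of_surj_inj (A B : Type) (f : A -> B) :
  injective f -> (forall y, exists x, f x = y) -> bijective f.
Proof.
move=> inj /choice_fun[g gK]; exists g => // x; by apply: inj; rewrite gK.
Qed.

Lemma digraph_iso_sym G H : digraph_iso G H -> digraph_iso H G.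
Proof.
move=> [f [g [[f' fK f'K] [g' gK g'K] ht hh]]]; exists f', g'; split.
- by exists f.
- by exists g.
- by move=> e; rewrite -{2}(g'K e) ht fK.
- by move=> e; rewrite -{2}(g'K e) hh fK.
Qed.

Lemma digraph_iso_trans G H K : digraph_iso G H -> digraph_iso H K -> digraph_iso G K.
Proof.
move=> [f [g [bf bg ht hh]]] [f2 [g2 [bf2 bg2 ht2 hh2]]].
exists (f2 \o f), (g2 \o g); split; try exact: bij_comp.
- by move=> e; rewrite /= ht2 ht.
- by move=> e; rewrite /= hh2 hh.
Qed.

(** [D] is [G] with the fibres of [pi] contracted. The arc map goes backwards: the image of [ga] is
    exactly the set of arcs between different fibres. With [D] fixed, fibres can be contracted one
    at a time. *)
Definition quotient (G D : digraph) (pi : vertex G -> vertex D) (ga : darc D -> darc G) :=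
  [/\ forall d, exists x, pi x = d, injective ga,
      forall e, pi (dtail (ga e)) = dtail e,
      forall e, pi (dhead (ga e)) = dhead e
    & forall e', pi (dtail e') != pi (dhead e') -> exists e, ga e = e'].

Lemma quotient_iso (G D : digraph) (pi : vertex G -> vertex D) ga :
  quotient pi ga -> injective pi -> digraph_iso G D.
Proof.
move=> [surj ginj ht hh hsur] inj.
have [|g gK Kg] := @bij_of_surj_inj _ _ ga ginj.
  by move=> e'; apply: hsur; apply: contraNneq (loopless e') => /inj ->.
exists pi, g; split; first exact: bij_of_surj_inj; first by exists ga.
- by move=> e; rewrite -{2}(Kg e) ht.
- by move=> e; rewrite -{2}(Kg e) hh.
Qed.

Section ContractVertex.
Variables (G : digraph) (S : {set vertex G}).

Lemma contract_vertex_eq (x y : vertex G) :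
  contract_vertex S x = contract_vertex S y -> x = y \/ (x \in S /\ y \in S).
Proof.
rewrite /contract_vertex; case: insubP => [u _ <-|]; case: insubP => [v _ <-|] //.
  by case=> ->; left.
by rewrite !negbK; right.
Qed.

Lemma contract_vertex_in (x : vertex G) : x \in S -> contract_vertex S x = None.
Proof. by move=> xS; apply: insubN; rewrite negbK. Qed.

Lemma contract_vertex_notin (x : vertex G) (xS : x \notin S) :
  contract_vertex S x = Some (Sub x xS).
Proof. exact: insubT. Qed.

Lemma contract_vertex_val (z : {v : vertex G | v \notin S}) :
  contract_vertex S (val z) = Some z.
Proof. exact: valK. Qed.

Lemma contract_vertex_surj z0 (X : vertex (contract S)) : z0 \in S -> exists x, contract_vertex S x = X.
Proof.
case: X => [z|] z0S; last by exists z0; apply: contract_vertex_in.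
by exists (val z); apply: contract_vertex_val.
Qed.

Lemma contract_quotient z0 : z0 \in S ->
  @quotient G (contract S) (contract_vertex S) val.
Proof.
move=> z0S; split=> //; first by move=> X; apply: contract_vertex_surj z0S.
  exact: val_inj.
move=> e' ne; have ins : ~~ ((dtail e' \in S) && (dhead e' \in S)).
  by apply: contraNN ne => /andP[h1 h2]; rewrite !contract_vertex_in.
by exists (Sub e' ins).
Qed.

End ContractVertex.

(** As [D] has no loops, no arc [ga e] has both ends in one fibre; so contracting a set inside a
    fibre loses none of them. *)
Lemma quotient_contract (G D : digraph) (pi : vertex G -> vertex D) ga
    (S : {set vertex G}) (d0 : vertex D) :
  quotient pi ga -> (forall x, x \in S -> pi x = d0) ->
  exists (pi1 : vertex (contract S) -> vertex D) (ga1 : darc D -> darc (contract S)),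
    [/\ quotient pi1 ga1, forall x, pi1 (contract_vertex S x) = pi x
      & pi1 None = d0].
Proof.
move=> [surj ginj ht hh hsur] Sd0.
have ok e : ~~ ((dtail (ga e) \in S) && (dhead (ga e) \in S)).
  apply/negP => /andP[/Sd0 h1 /Sd0 h2]; have := loopless e.
  by rewrite -ht -hh h1 h2 eqxx.
pose pi1 (X : vertex (contract S)) : vertex D := if X is Some z then pi (val z) else d0.
pose ga1 e : darc (contract S) := Sub (ga e) (ok e).
have pi1E x : pi1 (contract_vertex S x) = pi x.
  case: (boolP (x \in S)) => xS; first by rewrite contract_vertex_in ?Sd0.
  by rewrite contract_vertex_notin.
exists pi1, ga1; split=> //; split.
- by move=> d; case: (surj d) => x <-; exists (contract_vertex S x).
- by move=> e e' /(congr1 val); apply: ginj.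
- by move=> e; rewrite -ht -pi1E.
- by move=> e; rewrite -hh -pi1E.
- move=> e'; rewrite -[dtail e']/(contract_vertex S (dtail (val e'))).
  rewrite -[dhead e']/(contract_vertex S (dhead (val e'))) !pi1E => /hsur[e E].
  by exists e; apply: val_inj.
Qed.

Lemma contract_iso_quotient (G D : digraph) (pi : vertex G -> vertex D) ga
    (S : {set vertex G}) z0 :
  quotient pi ga -> z0 \in S -> (forall x, x \in S -> pi x = pi z0) ->
  (forall x y, pi x = pi y -> x = y \/ (x \in S /\ y \in S)) ->
  digraph_iso (contract S) D.
Proof.
move=> qt z0S Spi fib; have [pi1 [ga1 [q1 E _]]] := quotient_contract qt Spi.
apply: quotient_iso q1 _ => X Y.
case: (contract_vertex_surj X z0S) => x <-; case: (contract_vertex_surj Y z0S) => y <-.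
by rewrite !E => /fib[->|[xS yS]] //; rewrite !contract_vertex_in.
Qed.

Definition rel_in (G : digraph) (S : {set vertex G}) : rel (vertex G) :=
  fun x y => [&& x \in S, y \in S & arc x y].

Definition strong_in (G : digraph) (S : {set vertex G}) :=
  {in S &, forall x y, connect (rel_in S) x y}.

Section Induced.
Variables (G : digraph) (U : {set vertex G}).

Definition induced_arcs : {set darc G} := [set e | (dtail e \in U) && (dhead e \in U)].

Lemma induced_closed e : e \in induced_arcs -> (dtail e \in U) && (dhead e \in U).
Proof. by rewrite inE. Qed.

Definition induced : subdigraph G := Subdigraph induced_closed.

End Induced.

Lemma sub_arc (G : digraph) (K : subdigraph G) (x y : vertex K) e :
  e \in sarcs K -> dtail e = val x -> dhead e = val y -> arc x y.
Proof.
by move=> eK et eh; apply/arcP; exists (Sub e eK); apply: val_inj.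
Qed.

Lemma connect_sub (G : digraph) (K : subdigraph G) (S : {set vertex G}) :
  S \subset sverts K ->
  (forall x y, rel_in S x y -> exists2 e, e \in sarcs K & dtail e = x /\ dhead e = y) ->
  forall x y : vertex K, val x \in S -> val y \in S -> connect (rel_in S) (val x) (val y) ->
    connect (@rel_in K [set z | val z \in S]) x y.
Proof.
move=> SK arcs x y xS yS.
have h u v : rel_in S u v ->
    connect (@rel_in K [set z | val z \in S]) (insubd x u) (insubd x v).
  move=> uv; have /and3P[uS vS _] := uv; apply: connect1.
  have [e eK [et eh]] := arcs u v uv.
  have vu : val (insubd x u) = u by rewrite insubdK // (subsetP SK).
  have vv : val (insubd x v) = v by rewrite insubdK // (subsetP SK).
  by rewrite /rel_in !inE vu vv uS vS /=; apply: sub_arc eK _ _; rewrite ?vu ?vv.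
by move=> /(connect_map h); rewrite !valKd.
Qed.



Lemma strong_in_induced (G : digraph) (S : {set vertex G}) z0 :
  z0 \in S -> strong_in S -> strongly_connected (induced S).
Proof.
move=> z0S st; apply/stronglyP; split.
  by apply/card_gt0P; exists (Sub z0 z0S : vertex (induced S)).
move=> u v; have : connect (@rel_in (induced S) [set z | val z \in S]) u v.
  apply: connect_sub (st _ _ (valP u) (valP v)); rewrite ?(valP u) ?(valP v) //.
  move=> x y /and3P[xS yS /arcP[e et eh]]; exists e => //.
  by rewrite inE et eh xS.
by apply: (@connect_map _ _ _ _ id) => x y /and3P[_ _]; apply: connect1.
Qed.
Lemma strongly_strong_in (G : digraph) (K : subdigraph G) :
  strongly_connected K -> strong_in (sverts K).
Proof.
move=> /stronglyP[_ st] x y xK yK.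
have := st (Sub x xK : vertex K) (Sub y yK).
apply: (@connect_map _ _ _ _ val) => u v /arcP[e <- <-]; apply: connect1.
by rewrite /rel_in (valP (dtail e)) (valP (dhead e)) arc_dart.
Qed.
Lemma arc_contract (G : digraph) (S : {set vertex G}) (x y : vertex G) :
  arc x y -> ~~ ((x \in S) && (y \in S)) ->
  @arc (contract S) (contract_vertex S x) (contract_vertex S y).
Proof.
by move=> /arcP[e <- <-] ok; apply/arcP; exists (Sub e ok : darc (contract S)).
Qed.

Lemma card_contract (G : digraph) (S : {set vertex G}) :
  #|vertex (contract S)| = #|~: S|.+1.
Proof.
by rewrite card_option card_sig; congr _.+1; apply: eq_card => x; rewrite !inE.
Qed.

Lemma card_contract_lt (G : digraph) (S : {set vertex G}) x y :
  x \in S -> y \in S -> x != y -> #|vertex (contract S)| < #|vertex G|.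
Proof.
move=> xS yS xy; rewrite card_contract.
have : #|[set x; y]| <= #|S|.
  by apply: subset_leq_card; rewrite subUset !sub1set xS.
by rewrite cards2 xy -(cardsC S) /=; lia.
Qed.

Local Notation steps := (clos_refl_trans_1n digraph).

(** A whole fibre with at least two vertices is contracted at each step; the other fibres are
    untouched and stay strongly connected. *)
Lemma strong_quotient_steps (G D : digraph) (pi : vertex G -> vertex D) ga :
  quotient pi ga -> (forall d, strong_in [set x | pi x == d]) ->
  exists D', steps strong_step G D' /\ digraph_iso D' D.
Proof.
have [n] := ubnP #|vertex G|; elim: n G pi ga => // n IH G pi ga leG qt st.
case: (boolP (injectiveb pi)) => [/injectiveP inj|/injectivePn[x [y xy E]]].
  by exists G; split; [apply: rt1n_refl | apply: quotient_iso qt inj].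
pose S := [set z | pi z == pi x].
have xS : x \in S by rewrite inE.
have yS : y \in S by rewrite inE E.
have Spi z : z \in S -> pi z = pi x by rewrite inE => /eqP.
have [pi1 [ga1 [q1 E1 E0]]] := quotient_contract qt Spi.
have [||D' [sD' iD']] := IH _ pi1 ga1 _ q1.
- by have := card_contract_lt xS yS xy; lia.
- move=> d X Y; rewrite !inE => /eqP; case: (contract_vertex_surj X xS) => u <-.
  case: (contract_vertex_surj Y xS) => v <- pu /eqP pv; rewrite !E1 in pu pv.
  have [Ed|Nd] := eqVneq d (pi x).
    by rewrite !contract_vertex_in ?connect0 // inE ?pu ?pv Ed.
  have := st d u v; rewrite !inE pu pv eqxx => /(_ isT isT).
  apply: connect_map => z w /and3P[]; rewrite !inE => /eqP pz /eqP pw zw.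
  apply: connect1; rewrite /rel_in !inE !E1 pz pw eqxx /=.
  by apply: arc_contract; rewrite // !inE pz (negPf Nd).
exists D'; split=> //; apply: rt1n_trans sD'.
by apply: (@StrongStep G (induced S)); apply: strong_in_induced xS (st _).
Qed.

(** Strong minors expressed without contraction: branch sets and one chosen arc of [G] per arc of
    [H]. Injectivity of [al] accounts for parallel arcs. *)
Definition strong_model (H G : digraph) (B : vertex H -> {set vertex G})
    (al : darc H -> darc G) :=
  [/\ forall h, B h != set0, forall h, strong_in (B h),
      forall h h' x, x \in B h -> x \in B h' -> h = h', injective al
    & forall e, dtail (al e) \in B (dtail e) /\ dhead (al e) \in B (dhead e)].

Lemma strong_model_minor (H G : digraph) (B : vertex H -> {set vertex G}) al :
  strong_model B al -> strong_minor H G.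
Proof.
move=> [B0 Bst Bdis alinj alB].
pose W := [set x | [exists h, x \in B h]].
(* Between branch sets only the chosen arcs are kept, so that the quotient has no arcs beyond those
   of [H]. *)
pose A := [set e | [exists h, (dtail e \in B h) && (dhead e \in B h)] || [exists f, al f == e]].
have closedA e : e \in A -> (dtail e \in W) && (dhead e \in W).
  rewrite !inE => /orP[/existsP[h /andP[eh1 eh2]]|/existsP[f /eqP <-]].
    by apply/andP; split; apply/existsP; exists h.
  by case: (alB f) => h1 h2; apply/andP; split; apply/existsP; eexists; eassumption.
pose K := Subdigraph closedA.
have /choice_fun[pi hpi] (x : vertex K) : exists h, val x \in B h.
  by have := valP x; rewrite inE => /existsP.
have piE x h : val x \in B h -> pi x = h by move=> xh; apply: Bdis (hpi x) xh.
have alA f : al f \in A by rewrite inE; apply/orP; right; apply/existsP; exists f.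
pose ga f : darc K := Sub (al f) (alA f).
have qt : quotient pi ga.
  split.
  - move=> h; have /set0Pn[x xh] := B0 h.
    have xW : x \in sverts K by rewrite inE; apply/existsP; exists h.
    by exists (Sub x xW); apply: piE.
  - by move=> f f' /(congr1 val); apply: alinj.
  - by move=> f; apply: piE; case: (alB f).
  - by move=> f; apply: piE; case: (alB f).
  - move=> e' ne; have := valP e'; rewrite inE => /orP[/existsP[h /andP[h1 h2]]|].
      by rewrite (piE (dtail e') h) ?(piE (dhead e') h) ?eqxx in ne.
    by move=> /existsP[f /eqP E]; exists f; apply: val_inj.
have [|D' [sD' iD']] := strong_quotient_steps qt; last by exists K, D'.
move=> h x y; rewrite !inE => /eqP px /eqP py.
have xh : val x \in B h by rewrite -px.
have yh : val y \in B h by rewrite -py.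
have -> : [set z | pi z == h] = [set z : vertex K | val z \in B h].
  apply/setP => z; rewrite !inE; apply/eqP/idP => [<-|/piE] //.
apply: connect_sub => //; last exact: Bst.
  by apply/subsetP => z zh; rewrite inE; apply/existsP; exists h.
move=> u v /and3P[uh vh /arcP[e et eh]]; exists e => //.
by rewrite inE et eh; apply/orP; left; apply/existsP; exists h; rewrite uh.
Qed.

Definition embedding (G1 G2 : digraph) (f : vertex G1 -> vertex G2)
    (g : darc G1 -> darc G2) :=
  [/\ injective f, injective g, forall e, dtail (g e) = f (dtail e)
    & forall e, dhead (g e) = f (dhead e)].

Lemma sub_embedding (G : digraph) (K : subdigraph G) :
  @embedding K G val val.
Proof. by split=> //; apply: val_inj. Qed.

Lemma arc_embedding (G1 G2 : digraph) f g : @embedding G1 G2 f g ->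
  forall x y, arc x y -> arc (f x) (f y).
Proof. by move=> [_ _ ht hh] x y /arcP[e <- <-]; rewrite -ht -hh arc_dart. Qed.

Lemma strong_model_embedding (H G1 G2 : digraph) f g B al :
  @embedding G1 G2 f g -> @strong_model H G1 B al ->
  @strong_model H G2 (fun h => f @: B h) (g \o al).
Proof.
move=> em; have [finj ginj ht hh] := em; move=> [B0 Bst Bdis alinj alB]; split.
- by move=> h; have /set0Pn[x xh] := B0 h; apply/set0Pn; exists (f x); apply: imset_f.
- move=> h _ _ /imsetP[x xh ->] /imsetP[y yh ->].
  apply: connect_map (Bst h x y xh yh) => u v /and3P[uh vh uv]; apply: connect1.
  by rewrite /rel_in !imset_f //=; apply: arc_embedding em _ _ uv.
- move=> h h' _ /imsetP[x xh ->] /imsetP[y yh /finj E].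
  by apply: Bdis xh _; rewrite E.
- by move=> e e' /= /ginj /alinj.
- by move=> e /=; rewrite ht hh; case: (alB e) => h1 h2; rewrite !imset_f.
Qed.

(** Contractions are undone one by one: branch sets are replaced by their preimages, which stay
    strongly connected because the contracted set is. *)
Lemma strong_minor_model (H G : digraph) :
  strong_minor H G -> exists B al, @strong_model H G B al.
Proof.
move=> [K [D [st iso]]].
suff [B [al m]] : exists B al, @strong_model H K B al.
  by exists (fun h => val @: B h), (val \o al); apply: strong_model_embedding m; apply: sub_embedding.
elim: {K}(K : digraph) D / st iso => [D|K1 K2 D [K stK] _ IH iso].
  move=> /digraph_iso_sym[f [g [[f' fK f'K] [g' gK g'K] ht hh]]].
  exists (fun h => [set f h]), g; split.
  - by move=> h; apply/set0Pn; exists (f h); rewrite inE.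
  - by move=> h x y; rewrite !inE => /eqP -> /eqP ->.
  - by move=> h h' x; rewrite !inE => /eqP -> /eqP /(can_inj fK).
  - exact: can_inj gK.
  - by move=> e; rewrite !inE ht hh !eqxx.
have [B [al [B0 Bst Bdis alinj alB]]] := IH iso.
have /stronglyP[/card_gt0P[z0 _] _] := stK.
exists (fun h => [set x | contract_vertex (sverts K) x \in B h]), (val \o al); split.
- move=> h; have /set0Pn[X Xh] := B0 h.
  case: (contract_vertex_surj X (valP z0)) => x xX.
  by apply/set0Pn; exists x; rewrite inE xX.
- move=> h x y xh yh.
  apply: (@connect_lift _ _ _ (rel_in (B h)) (contract_vertex (sverts K))
            (mem [set x | contract_vertex (sverts K) x \in B h])) => //.
  + move=> u v uh vh /contract_vertex_eq[->|[uS vS]]; first exact: connect0.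
    have uN : None \in B h by move: uh; rewrite /= inE contract_vertex_in.
    apply: (@connect_map _ _ _ _ id) (strongly_strong_in stK uS vS) => z w /and3P[zS wS zw].
    by apply: connect1; rewrite /rel_in !inE !contract_vertex_in // uN.
  + move=> X Y /and3P[Xh Yh /arcP[e et eh]]; exists (dtail (val e)), (dhead (val e)).
    rewrite -et -eh in Xh Yh.
    by rewrite /= /rel_in !inE Xh Yh arc_dart.
  + by rewrite !inE in xh yh; apply: Bst.
- by move=> h h' x; rewrite !inE; apply: Bdis.
- by move=> e e' /val_inj /alinj.
- by move=> e; rewrite !inE; apply: alB.
Qed.

(** * Topological minors *)

(** A subdivision inside a larger digraph. Arc-disjointness is a separate clause because parallel
    arcs of [H] could otherwise share a path of length one, which has no inner vertex. *)
Definition topo_model (H G : digraph) (phi : vertex H -> vertex G)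
    (P : darc H -> seq (darc G)) :=
  [/\ injective phi,
      forall e, dipath (phi (dtail e)) (P e) (phi (dhead e)),
      forall e v, phi v \notin inner_vertices (P e),
      forall e e' x, x \in inner_vertices (P e) -> x \in inner_vertices (P e') -> e = e'
    & forall e e' a, a \in P e -> a \in P e' -> e = e'].

Section Embedding.
Variables (G1 G2 : digraph) (f : vertex G1 -> vertex G2) (g : darc G1 -> darc G2).
Hypothesis em : embedding f g.

Lemma dipath_embedding u p v : dipath (f u) (map g p) (f v) = dipath u p v.
Proof.
have [finj ginj ht hh] := em.
have wE : diwalk (f u) (map g p) (f v) = diwalk u p v.
  by elim: p u => [|e p IH] u /=; rewrite ?ht ?hh ?IH (inj_eq finj).
have hE : [seq dhead e | e <- map g p] = map f [seq dhead e | e <- p].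
  by rewrite -!map_comp; apply: eq_map => e /=.
by rewrite /dipath wE hE -map_cons map_inj_uniq.
Qed.

Lemma inner_embedding p : inner_vertices (map g p) = map f (inner_vertices p).
Proof.
have [finj ginj ht hh] := em.
by rewrite /inner_vertices behead_map -!map_comp; apply: eq_map => e /=; rewrite ht.
Qed.

Lemma topo_embedding (H : digraph) phi P :
  @topo_model H G1 phi P -> topo_model (f \o phi) (map g \o P).
Proof.
have [finj ginj ht hh] := em; move=> [inj pth phiN dis adis]; split=> //=.
- exact: inj_comp.
- by move=> e; rewrite dipath_embedding.
- by move=> e v; rewrite inner_embedding mem_map.
- move=> e e' x; rewrite !inner_embedding => /mapP[y ye ->].
  by rewrite mem_map // => ye'; apply: dis ye ye'.
- move=> e e' a /mapP[b be ->]; rewrite mem_map // => be'; exact: adis be be'.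
Qed.

End Embedding.

Lemma lift_seq (T : Type) (q : pred T) (s : seq T) :
  all q s -> exists s' : seq {x | q x}, map val s' = s.
Proof.
elim: s => [|x s IH] /=; first by exists [::].
by move=> /andP[qx /IH[s' <-]]; exists (Sub x qx :: s').
Qed.

Lemma topo_sub (H G : digraph) (K : subdigraph G) phi P :
  @topo_model H G phi P -> (forall v, phi v \in sverts K) ->
  (forall e a, a \in P e -> a \in sarcs K) ->
  exists phi' P', [/\ @topo_model H K phi' P', forall v, val (phi' v) = phi v
                    & forall e, map val (P' e) = P e].
Proof.
move=> [inj pth phiN dis adis] phiK PK.
pose phi' v : vertex K := Sub (phi v) (phiK v).
have /choice_fun[P' P'E] e : exists p : seq (darc K), map val p = P e.
  have /lift_seq[p <-] : all (fun a => a \in sarcs K) (P e).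
    by apply/allP => a; apply: PK.
  by exists p.
have em := sub_embedding K; have phiE v : val (phi' v) = phi v by [].
have innE e : map val (inner_vertices (P' e)) = inner_vertices (P e).
  by have := inner_embedding em (P' e); rewrite P'E.
exists phi', P'; split=> //; split.
- by move=> u v /(congr1 val); apply: inj.
- by move=> e; have := dipath_embedding em (phi' (dtail e)) (P' e) (phi' (dhead e)); rewrite P'E /= pth.
- by move=> e v; have := phiN e v; rewrite -innE -phiE mem_map //; apply: val_inj.
- move=> e e' x xe xe'; apply: (dis e e' (val x)).
  + by rewrite -innE map_f.
  + by rewrite -innE map_f.
- move=> e e' a ae ae'; apply: (adis e e' (val a)).
  + by rewrite -P'E map_f.
  + by rewrite -P'E map_f.
Qed.

Lemma diwalk_ends (G : digraph) (u v : vertex G) p a : diwalk u p v -> a \in p ->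
  (dtail a = u \/ dtail a \in inner_vertices p) /\
  (dhead a = v \/ dhead a \in inner_vertices p).
Proof.
rewrite /inner_vertices; elim: p u => //= b p IH u /andP[/eqP bu wp].
rewrite inE => /predU1P[->|ap]; split; rewrite ?bu; try by left.
- case: p wp {IH} => [|c p] /=; first by move/eqP->; left.
  by move=> /andP[/eqP <- _]; right; rewrite mem_head.
- by right; apply: map_f.
- case: (IH _ wp ap) => _ [->|h]; [by left | right].
  by case: p {IH wp ap} h => //= c p h; rewrite inE h orbT.
Qed.

Lemma inner_connect (G : digraph) (u v x : vertex G) p : diwalk u p v ->
  x \in inner_vertices p -> connect (@arc G) u x /\ connect (@arc G) x v.
Proof.
rewrite /inner_vertices; elim: p u => //= b p IH u /andP[/eqP bu wp].
have ub : connect (@arc G) u (dhead b) by rewrite -bu connect1 // arc_dart.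
case: p wp IH => [|c p] //= /andP[/eqP cb wp] IH.
rewrite inE => /predU1P[->|xp].
  rewrite cb; split=> //; apply: (@connect_diwalk _ _ _ (c :: p)).
  by rewrite /= cb eqxx.
have [|h1 h2] := IH (dhead b) _ xp; first by rewrite cb eqxx.
by split=> //; apply: connect_trans ub h1.
Qed.

Lemma inner_sub_heads (G : digraph) (u v : vertex G) p : diwalk u p v ->
  {subset inner_vertices p <= map (@dhead G) p}.
Proof.
rewrite /inner_vertices; elim: p u => //= b p IH u /andP[/eqP bu wp].
case: p wp IH => [|c p] //= /andP[/eqP cb wp] IH x.
rewrite inE cb => /predU1P[->|xp]; first by rewrite mem_head.
by rewrite inE (IH (dhead b)) ?orbT // cb eqxx.
Qed.

Lemma diwalk_index (G : digraph) (u v : vertex G) p a : diwalk u p v ->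
  uniq (u :: map (@dhead G) p) -> a \in p ->
  index (dtail a) (u :: map (@dhead G) p) < index (dhead a) (u :: map (@dhead G) p).
Proof.
elim: p u => //= b p IH u /andP[/eqP bu wp]; rewrite inE negb_or.
move=> /andP[/andP[ub up] un]; rewrite inE => /predU1P[->|ap].
  by rewrite bu eqxx (negPf ub).
have := IH _ wp un ap; have ha : u != dhead a.
  by apply: contraNneq up => ->; apply: map_f.
have [Ea|] := eqVneq u (dtail a); first by rewrite (negPf ha).
by rewrite (negPf ha).
Qed.

Lemma diwalk_last (G : digraph) (u v : vertex G) p : diwalk u p v -> u != v ->
  exists a, a \in p /\ dhead a = v.
Proof.
elim: p u => /= [u -> //|b p IH u /andP[_ wp] _].
have [<-|ne] := eqVneq (dhead b) v; first by exists b; rewrite mem_head.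
by case: (IH _ wp ne) => a [ap <-]; exists a; rewrite inE ap orbT.
Qed.

Lemma topo_model_minor (H G : digraph) phi P :
  @topo_model H G phi P -> topological_minor H G.
Proof.
move=> m; have [inj pth phiN dis adis] := m.
pose W := [set x | [exists v, phi v == x] || [exists e, x \in inner_vertices (P e)]].
pose A := [set a | [exists e, a \in P e]].
have Wphi v : phi v \in W by rewrite inE; apply/orP; left; apply/existsP; exists v.
have Winn e x : x \in inner_vertices (P e) -> x \in W.
  by rewrite inE => xe; apply/orP; right; apply/existsP; exists e.
have closedA a : a \in A -> (dtail a \in W) && (dhead a \in W).
  rewrite inE => /existsP[e ae]; have /andP[wk _] := pth e.
  by case: (diwalk_ends wk ae) => [[->|/Winn->] [->|/Winn->]]; rewrite ?Wphi.
have AP e a : a \in P e -> a \in sarcs (Subdigraph closedA).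
  by move=> ae; rewrite inE; apply/existsP; exists e.
have [phi' [P' [m' phiE PE]]] := topo_sub m (Wphi : forall v, _ \in sverts (Subdigraph closedA)) AP.
have [inj' pth' phiN' dis' adis'] := m'.
exists (Subdigraph closedA), phi', P'; split=> //; split.
- move=> x; have := valP x; rewrite inE => /orP[/existsP[v /eqP E]|/existsP[e xe]].
    by left; exists v; apply: val_inj; rewrite phiE E.
  right; exists e; move: xe; rewrite -PE.
  by rewrite (inner_embedding (sub_embedding _)) mem_map //; apply: val_inj.
- move=> a; have := valP a; rewrite inE => /existsP[e]; rewrite -PE mem_map; last exact: val_inj.
  by move=> ae; exists e; split=> // e' ae'; apply: adis' ae ae'.
Qed.

Lemma topo_minor_model (H G : digraph) :
  topological_minor H G -> exists phi P, @topo_model H G phi P.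
Proof.
move=> [K [phi [P [[h1 h2 h3 h4] [_ uq]]]]].
exists (val \o phi), (map val \o P); apply: topo_embedding; first exact: sub_embedding.
split=> // e e' a ae ae'; case: (uq a) => e0 [_ u0].
by rewrite -(u0 _ ae) -(u0 _ ae').
Qed.

Lemma topo_minor_induced (H G : digraph) phi P (U : {set vertex G}) :
  @topo_model H G phi P -> (forall v, phi v \in U) ->
  (forall e x, x \in inner_vertices (P e) -> x \in U) ->
  topological_minor H (induced U).
Proof.
move=> m phiU innU; have [_ pth _ _ _] := m.
have [|phi' [P' [m' _ _]]] := topo_sub (K := induced U) m phiU; last first.
  exact: topo_model_minor m'.
move=> e a ae; rewrite inE; have /andP[wk _] := pth e.
by case: (diwalk_ends wk ae) => [[->|/innU->] [->|/innU->]]; rewrite ?phiU.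
Qed.

(** The paths connect branch vertices as [H] does, and every inner vertex lies on a path between
    branch vertices; so the whole model is one part. *)
Lemma topo_localize (H G : digraph) : strongly_connected H ->
  topological_minor H G ->
  exists U : {set vertex G}, [/\ U != set0, {in U &, forall x y, connect (@arc G) x y}
    & topological_minor H (induced U)].
Proof.
move=> /stronglyP[/card_gt0P[h0 _] Hst] /topo_minor_model[phi [P m]].
have [inj pth phiN dis adis] := m.
pose U := [set x | [exists v, phi v == x] || [exists e, x \in inner_vertices (P e)]].
have Uphi v : phi v \in U by rewrite inE; apply/orP; left; apply/existsP; exists v.
have Uinn e x : x \in inner_vertices (P e) -> x \in U.
  by rewrite inE => xe; apply/orP; right; apply/existsP; exists e.
have cphi v w : connect (@arc G) (phi v) (phi w).
  apply: connect_map (Hst v w) => x y /arcP[e <- <-].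
  by have /andP[/connect_diwalk] := pth e.
have link x : x \in U -> connect (@arc G) (phi h0) x /\ connect (@arc G) x (phi h0).
  rewrite inE => /orP[/existsP[v /eqP <-]|/existsP[e xe]]; first by split; apply: cphi.
  have /andP[wk _] := pth e; case: (inner_connect wk xe) => h1 h2.
  by split; [apply: connect_trans h1 | apply: connect_trans h2 _].
exists U; split; first by apply/set0Pn; exists (phi h0).
  by move=> x y /link[_ h1] /link[h2 _]; apply: connect_trans h1 h2.
exact: topo_minor_induced m Uphi Uinn.
Qed.

(* The arcs to contract are the unique incoming arcs of the vertices outside [R];
   the ranks exclude directed cycles of such arcs. *)
Lemma out_quotient_steps (G D : digraph) (pi : vertex G -> vertex D) ga
    (R : pred (vertex G)) (rk : vertex G -> nat) :
  quotient pi ga ->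
  (forall x y, R x -> R y -> pi x = pi y -> x = y) ->
  (forall x, ~~ R x -> exists e, [/\ dhead e = x, forall e', dhead e' = x -> e' = e,
     pi (dtail e) = pi x & rk (dtail e) < rk x]) ->
  exists D', steps butterfly_step G D' /\ digraph_iso D' D.
Proof.
have [n] := ubnP #|vertex G|; elim: n G pi ga R rk => // n IH G pi ga R rk leG qt Rinj nR.
case: (boolP [forall x, R x]) => [/forallP allR|].
  exists G; split; first exact: rt1n_refl.
  by apply: quotient_iso qt _ => x y; apply: Rinj.
rewrite negb_forall => /existsP[x nRx].
have [e [ex euq pe rke]] := nR x nRx.
pose S := [set dtail e; dhead e]; set y := dtail e in pe rke S.
have yS : y \in S by rewrite !inE eqxx.
have xS : x \in S by rewrite !inE ex eqxx orbT.
have Spi z : z \in S -> pi z = pi x by rewrite !inE ex => /orP[] /eqP ->.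
have inS z : z \in S -> z = y \/ z = x by rewrite !inE ex => /orP[] /eqP ->; [left|right].
have [pi1 [ga1 [q1 E1 E0]]] := quotient_contract qt Spi.
(* The merged vertex inherits from the tail [y], whose rank is the smaller one. *)
pose R1 (X : vertex (contract S)) := if X is Some z then R (val z) else R y.
pose rk1 (X : vertex (contract S)) := if X is Some z then rk (val z) else rk y.
have rk1E z : rk1 (contract_vertex S z) <= rk z.
  case: (boolP (z \in S)) => zS; last by rewrite contract_vertex_notin.
  by rewrite contract_vertex_in //; case: (inS z zS) => ->; rewrite //= ltnW.
have [|||D' [sD' iD']] := IH (contract S) pi1 ga1 R1 rk1 _ q1.
- by have := card_contract_lt yS xS; rewrite -ex loopless => /(_ isT); lia.
- move=> [z|] [w|] //=; rewrite -?contract_vertex_val ?E1 ?E0 => Rz Rw E.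
  + by congr contract_vertex; apply: Rinj.
  + have Ez : val z = y by apply: Rinj; rewrite // E pe.
    have : val z \notin S := valP z; by rewrite Ez yS.
  + have Ew : val w = y by apply: Rinj; rewrite // -E pe.
    have : val w \notin S := valP w; by rewrite Ew yS.
- move=> [z|] /= nRz.
    have [ez [hz uz pz rz]] := nR _ nRz.
    have ok : ~~ ((dtail ez \in S) && (dhead ez \in S)) by rewrite hz (negPf (valP z)) andbF.
    exists (Sub ez ok : darc (contract S)); split.
    + by rewrite -[LHS]/(contract_vertex S (dhead ez)) hz contract_vertex_val.
    + move=> e' he'; apply: val_inj; apply: uz.
      have: contract_vertex S (dhead (val e')) = contract_vertex S (val z).
        by rewrite contract_vertex_val -he'.
      case/contract_vertex_eq => // -[_ zS]; by have := valP z; rewrite zS.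
    + have -> : pi1 (Some z) = pi (val z) by rewrite -E1 contract_vertex_val.
      by rewrite -[RHS]pz -E1.
    + by apply: leq_ltn_trans (rk1E _) _.
  have [ez [hz uz pz rz]] := nR _ nRz.
  (* The incoming arc of [y] starts at a rank below those of [y] and [x], hence outside [S], and
     survives the contraction. *)
  have tz : dtail ez \notin S.
    apply/negP => /inS[] E; rewrite E in rz; last by move: rz rke; lia.
    by rewrite ltnn in rz.
  have ok : ~~ ((dtail ez \in S) && (dhead ez \in S)) by rewrite (negPf tz).
  exists (Sub ez ok : darc (contract S)); split.
  + by rewrite -[LHS]/(contract_vertex S (dhead ez)) hz contract_vertex_in.
  + move=> e' he'; apply: val_inj; apply: uz.
    have hS : dhead (val e') \in S.
      apply/negPn/negP => nS; have := contract_vertex_notin nS.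
      by rewrite (he' : contract_vertex S (dhead (val e')) = None).
    case: (inS _ hS) => // /euq E; have := valP e'.
    by rewrite E -/y yS ex xS.
  + by rewrite E0 -pe -[RHS]pz -E1.
  + by apply: leq_ltn_trans (rk1E _) _.
exists D'; split=> //; apply: rt1n_trans sD'.
by apply: (ButterflyStep (e := e)); left=> e'; rewrite ex; apply: euq.
Qed.

(** An inner vertex of a subdivided arc has a single incoming arc, so each path can be shrunk into
    its tail; its last arc survives as the arc of [H]. *)
Lemma subdivision_butterfly (H K : digraph) : subdivision H K ->
  exists D, steps butterfly_step K D /\ digraph_iso D H.
Proof.
move=> [phi [P [[inj pth phiN dis] [cov uq]]]].
have /choice_fun[pi hpi] x : exists v, x = phi v \/ exists2 e, x \in inner_vertices (P e) & v = dtail e.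
  by case: (cov x) => [[v]|[e xe]]; [exists v; left | exists (dtail e); right; exists e].
have pi_phi v : pi (phi v) = v.
  by case: (hpi (phi v)) => [/inj //|[e]]; rewrite (negPf (phiN e v)).
have pi_inn e x : x \in inner_vertices (P e) -> pi x = dtail e.
  move=> xe; case: (hpi x) => [E|[e' xe' ->]]; last by rewrite (dis _ _ _ xe xe').
  by have := phiN e (pi x); rewrite -E xe.
have wk e : diwalk (phi (dtail e)) (P e) (phi (dhead e)) by case/andP: (pth e).
have un e : uniq (phi (dtail e) :: map (@dhead K) (P e)) by case/andP: (pth e).
have /choice_fun[ga hga] e : exists a, a \in P e /\ dhead a = phi (dhead e).
  apply: diwalk_last (wk e) _; apply: contraNneq (loopless e) => /inj.
  by move=> ->.
have heads_inj e a b : a \in P e -> b \in P e -> dhead a = dhead b -> a = b.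
  move=> ae be; have /= /andP[_ uh] := un e.
  move=> E; rewrite -[a](nth_index a ae) -[b](nth_index a be); congr nth.
  apply/eqP; rewrite -(nth_uniq (dhead a) _ _ uh) ?size_map ?index_mem //.
  by rewrite !(nth_map a) ?index_mem // !nth_index ?E.
have pi_tail e a : a \in P e -> pi (dtail a) = dtail e.
  by move=> /(diwalk_ends (wk e))[[->|/pi_inn ->] _] //; rewrite pi_phi.
have qt : quotient pi ga.
  split.
  - by move=> v; exists (phi v).
  - move=> e e' E; case: (hga e) (hga e') => h1 _ [h2 _].
    case: (uq (ga e)) => e0 [_ u0]; rewrite -(u0 e h1); apply: u0; by rewrite E.
  - by move=> e; apply: pi_tail; case: (hga e).
  - by move=> e; case: (hga e) => _ ->.
  - move=> a ne; case: (uq a) => e [ae _]; exists e; case: (hga e) => h1 h2.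
    apply: (heads_inj _ _ _ h1 ae); rewrite h2.
    case: (diwalk_ends (wk e) ae) => _ [//|/pi_inn E].
    by rewrite E (pi_tail e a ae) eqxx in ne.
(* Ranks are positions along the path; branch vertices, which may lie on several paths, get 0. *)
pose rk x := if [pick e | x \in inner_vertices (P e)] is Some e
  then index x (phi (dtail e) :: map (@dhead K) (P e)) else 0.
have rk_inn e x : x \in inner_vertices (P e) ->
    rk x = index x (phi (dtail e) :: map (@dhead K) (P e)).
  rewrite /rk => xe; case: pickP => [e' xe'|/(_ e)]; last by rewrite xe.
  by rewrite (dis _ _ _ xe xe').
have rk_phi v : rk (phi v) = 0.
  by rewrite /rk; case: pickP => // e; rewrite (negPf (phiN e v)).
apply: (@out_quotient_steps _ _ pi ga (fun x => [exists v, phi v == x]) rk qt).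
  by move=> x y /existsP[v /eqP <-] /existsP[w /eqP <-]; rewrite !pi_phi => ->.
move=> x nphi; case: (cov x) => [[v E]|[e xe]].
  by case/negP: nphi; apply/existsP; exists v; rewrite E.
have /mapP[a ae ax] := inner_sub_heads (wk e) xe.
exists a; split=> //.
- move=> b bx; case: (uq b) => e' [be' _].
  case: (diwalk_ends (wk e') be') => _ [E|xe'].
    by case/negP: nphi; apply/existsP; exists (dhead e'); rewrite -E bx.
  rewrite bx in xe'; rewrite (dis _ _ _ xe' xe) in be'.
  by apply: heads_inj be' ae _; rewrite bx.
- by rewrite (pi_tail e a ae) (pi_inn e x xe).
- have lt := diwalk_index (wk e) (un e) ae.
  rewrite (rk_inn e x xe) ax; apply: leq_ltn_trans lt.
  by case: (diwalk_ends (wk e) ae) => [[->|/rk_inn ->] _] //; rewrite rk_phi.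
Qed.

Lemma topo_butterfly (H G : digraph) : topological_minor H G -> butterfly_minor H G.
Proof. by move=> [K /subdivision_butterfly[D hD]]; exists K, D. Qed.

(** * Butterfly minors *)

Lemma butterfly_step_iso (G G' D : digraph) : digraph_iso G G' ->
  butterfly_step G D -> exists2 D', butterfly_step G' D' & digraph_iso D D'.
Proof.
move=> [f [g [[f' fK f'K] [g' gK g'K] ht hh]]] [e ce].
exists (contract [set dtail (g e); dhead (g e)]).
  apply: ButterflyStep; case: ce => [ce|ce]; [left|right] => e' E.
    by rewrite -(ce (g' e')) ?g'K //; apply: (can_inj fK); rewrite -!hh g'K.
  by rewrite -(ce (g' e')) ?g'K //; apply: (can_inj fK); rewrite -!ht g'K.
set S := [set dtail e; dhead e]; set S' := [set dtail (g e); dhead (g e)].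
have tS : dtail e \in S by rewrite !inE eqxx.
have tS' : dtail (g e) \in S' by rewrite !inE eqxx.
have SS' x : (f x \in S') = (x \in S) by rewrite !inE ht hh !(can_eq fK).
have [surj' ginj' ht' hh' hsur'] := contract_quotient tS'.
apply: (@contract_iso_quotient G (contract S') (contract_vertex S' \o f) (g' \o val) S (dtail e)) => //.
- split.
  + by move=> X; case: (surj' X) => x' <-; exists (f' x'); rewrite /= f'K.
  + by move=> a b /= /(can_inj g'K) /val_inj.
  + by move=> a; rewrite /= -ht g'K.
  + by move=> a; rewrite /= -hh g'K.
  + by move=> a /=; rewrite -ht -hh => /hsur'[b E]; exists b; rewrite /= E gK.
- by move=> x xS /=; rewrite !contract_vertex_in ?SS'.
- move=> x y /= /contract_vertex_eq[/(can_inj fK)->|]; first by left.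
  by rewrite !SS'; right.
Qed.

Lemma butterfly_steps_iso (G G' D : digraph) : digraph_iso G G' ->
  steps butterfly_step G D -> exists2 D', steps butterfly_step G' D' & digraph_iso D D'.
Proof.
move=> iso st; elim: st G' iso => [D0|G0 G1 D0 s01 _ IH] G' iso.
  by exists G' => //; apply: rt1n_refl.
have [G1' s' iso1] := butterfly_step_iso iso s01.
have [D' st' isoD] := IH _ iso1.
by exists D' => //; apply: rt1n_trans st'.
Qed.

Lemma embedding_iso (G1 G2 : digraph) f g : @embedding G1 G2 f g ->
  exists K : subdigraph G2, digraph_iso G1 K.
Proof.
move=> [finj ginj ht hh].
have closed a : a \in g @: setT -> (dtail a \in f @: setT) && (dhead a \in f @: setT).
  by move=> /imsetP[e _ ->]; rewrite ht hh !imset_f.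
have fK x : f x \in sverts (Subdigraph closed) by apply: imset_f.
have gK e : g e \in sarcs (Subdigraph closed) by apply: imset_f.
exists (Subdigraph closed), (fun x => Sub (f x) (fK x)), (fun e => Sub (g e) (gK e)).
split.
- apply: bij_of_surj_inj => [x y /(congr1 val) /finj //|y].
  by have /imsetP[x _ E] := valP y; exists x; apply: val_inj.
- apply: bij_of_surj_inj => [x y /(congr1 val) /ginj //|y].
  by have /imsetP[x _ E] := valP y; exists x; apply: val_inj.
- by move=> e; apply: val_inj; rewrite /= ht.
- by move=> e; apply: val_inj; rewrite /= hh.
Qed.

Lemma butterfly_minor_of_embedding (H G K D : digraph) f g :
  @embedding K G f g -> steps butterfly_step K D -> digraph_iso D H ->
  butterfly_minor H G.
Proof.
move=> /embedding_iso[K' iso] st isoD.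
have [D' st' iso'] := butterfly_steps_iso iso st.
by exists K', D'; split=> //; apply: digraph_iso_trans (digraph_iso_sym iso') isoD.
Qed.

(** * Undoing butterfly contractions while keeping strong connectivity *)

Lemma strongly_iso (G G' : digraph) :
  digraph_iso G G' -> strongly_connected G' -> strongly_connected G.
Proof.
move=> /digraph_iso_sym[f [g [[f' fK f'K] _ ht hh]]] /stronglyP[/card_gt0P[x _] st].
apply/stronglyP; split; first by apply/card_gt0P; exists (f x).
move=> u v; rewrite -(f'K u) -(f'K v); apply: connect_map (st _ _) => y z /arcP[e <- <-].
by rewrite -ht -hh connect1 // arc_dart.
Qed.

(** The lift never enters [v], so a path towards the fibre of [v] must arrive at [u]. Applied
    directly or to reversed arcs, this gives the return path from the head of the contracted arc to
    its tail. *)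
Lemma connect_to_root (T T' : finType) (r : rel T) (r' : rel T') (pi : T -> T') (u v : T) :
  (forall x y, pi x = pi y -> x = y \/ pi x = pi v) ->
  (forall x, pi x = pi v -> x = u \/ x = v) ->
  (forall X Y, r' X Y -> exists x y, [/\ pi x = X, pi y = Y, y != v & r x y]) ->
  forall x, x != v -> connect r' (pi x) (pi v) -> connect r x u.
Proof.
move=> fib fibv lift x xv /connectP[p].
elim: p x xv => [|Z p IH] x xv /=.
  by move=> _ /esym /fibv[->|E]; [apply: connect0 | rewrite E eqxx in xv].
move=> /andP[/lift[x' [y [px py yv xy]]] pZ] ly.
case: (fib x x' (esym px)) => [->|/fibv[->|E]]; last 1 first.
- by rewrite E eqxx in xv.
- by apply: connect_trans (connect1 xy) (IH y yv _ _); rewrite py.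
- exact: connect0.
Qed.

Section Lift.

Variables (G : digraph) (e : darc G).
Notation S := [set dtail e; dhead e].
Variable K1 : subdigraph (contract S).
Hypothesis K1st : strongly_connected K1.

Let tS : dtail e \in S. Proof. by rewrite !inE eqxx. Qed.
Let hS : dhead e \in S. Proof. by rewrite !inE eqxx orbT. Qed.

(* [w] is the end of the contracted arc that can be dropped. *)
Lemma lift_without_arc (w k : vertex G) :
  S = [set k; w] -> k != w ->
  (forall f, f \in sarcs K1 -> (dtail (val f) != w) && (dhead (val f) != w)) ->
  exists K' : subdigraph G, strongly_connected K' /\
    exists D', steps butterfly_step K' D' /\ digraph_iso D' K1.
Proof.
move=> SE kw noinc.
pose W := [set x | (x != w) && (contract_vertex S x \in sverts K1)].
have closed a : a \in [set val f | f in sarcs K1] -> (dtail a \in W) && (dhead a \in W).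
  move=> /imsetP[f fK ->]; rewrite !inE; case/andP: (noinc f fK) => -> ->.
  by case/andP: (sarcs_closed fK) => /= -> ->.
pose K' := Subdigraph closed.
have cK (x : vertex K') : contract_vertex S (val x) \in sverts K1.
  by have := valP x; rewrite inE => /andP[].
pose pi (x : vertex K') : vertex K1 := Sub (contract_vertex S (val x)) (cK x).
have gaK (f : darc K1) : val (val f) \in sarcs K' by apply: imset_f; apply: valP.
pose ga (f : darc K1) : darc K' := Sub (val (val f)) (gaK f).
have qt : quotient pi ga.
  split.
  - move=> X; have XK := valP X; have [x [xw xX]] : exists x, x != w /\ contract_vertex S x = val X.
      case EX : (val X) => [z|]; last first.
        by exists k; rewrite contract_vertex_in // SE !inE eqxx.
      exists (val z); rewrite contract_vertex_val; split=> //.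
      have : val z \notin S := valP z.
      by apply: contraNneq => ->; rewrite SE !inE eqxx orbT.
    have xK : x \in sverts K' by rewrite inE xw xX XK.
    by exists (Sub x xK); apply: val_inj.
  - by move=> f f' /(congr1 val) /= /val_inj /val_inj.
  - by move=> f; apply: val_inj.
  - by move=> f; apply: val_inj.
  - move=> a _; have /imsetP[f fK E] := valP a.
    by exists (Sub f fK); apply: val_inj.
have iso : digraph_iso K' K1.
  apply: quotient_iso qt _ => x y /(congr1 val) /= /contract_vertex_eq.
  case=> [/val_inj //|[xS yS]]; apply: val_inj.
  have := valP x; have := valP y; rewrite !inE => /andP[yw _] /andP[xw _].
  by move: xS yS; rewrite SE !inE (negPf xw) (negPf yw) !orbF => /eqP Ex /eqP Ey; apply: etrans Ex (esym Ey).
exists K'; split; first exact: strongly_iso iso K1st.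
by exists K'; split=> //; apply: rt1n_refl.
Qed.

Lemma lift_with_arc f :
  f \in sarcs K1 ->
  ((forall a : darc G, dhead a = dhead e -> a = e) /\ dtail (val f) = dhead e) \/
  ((forall a : darc G, dtail a = dtail e -> a = e) /\ dhead (val f) = dtail e) ->
  exists K' : subdigraph G, strongly_connected K' /\
    exists D', steps butterfly_step K' D' /\ digraph_iso D' K1.
Proof.
move=> fK hf.
have NK : None \in sverts K1.
  case/andP: (sarcs_closed fK) => ft fh; case: hf => -[_ E].
    by move: ft; rewrite /= /contract_tail E contract_vertex_in.
  by move: fh; rewrite /= /contract_head E contract_vertex_in.
pose W := [set x | contract_vertex S x \in sverts K1].
have tW : dtail e \in W by rewrite inE contract_vertex_in.
have hW : dhead e \in W by rewrite inE contract_vertex_in.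
have closed a : a \in e |: [set val f | f in sarcs K1] -> (dtail a \in W) && (dhead a \in W).
  move=> /setU1P[->|/imsetP[f0 f0K ->]]; first by rewrite tW.
  by rewrite !inE; case/andP: (sarcs_closed f0K) => /= -> ->.
pose K' := Subdigraph closed.
have cK (x : vertex K') : contract_vertex S (val x) \in sverts K1.
  by have := valP x; rewrite inE.
pose pi (x : vertex K') : vertex K1 := Sub (contract_vertex S (val x)) (cK x).
have gaK (f0 : darc K1) : val (val f0) \in sarcs K' by apply: setU1r; apply: imset_f; apply: valP.
pose ga (f : darc K1) : darc K' := Sub (val (val f)) (gaK f).
pose u : vertex K' := Sub (dtail e) tW; pose v : vertex K' := Sub (dhead e) hW.
have eK : e \in sarcs K' by apply: setU11.
pose e' : darc K' := Sub e eK.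
have te' : dtail e' = u by apply: val_inj.
have he' : dhead e' = v by apply: val_inj.
have fib x y : pi x = pi y -> x = y \/ (val x \in S /\ val y \in S).
  by move=> /(congr1 val) /= /contract_vertex_eq[/val_inj|]; [left|right].
have piS x : val x \in S -> pi x = pi v.
  by move=> xS; apply: val_inj; rewrite /= !contract_vertex_in.
have inS x : val x \in S -> x = u \/ x = v.
  by rewrite !inE => /orP[]/eqP E; [left|right]; apply: val_inj.
have piuv : pi u = pi v by apply: piS.
have qt : quotient pi ga.
  split.
  - move=> X; have XK := valP X.
    have [x xX] := contract_vertex_surj (val X) tS.
    have xK : x \in sverts K' by rewrite inE xX XK.
    by exists (Sub x xK); apply: val_inj.
  - by move=> f1 f2 /(congr1 val) /= /val_inj /val_inj.
  - by move=> f1; apply: val_inj.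
  - by move=> f1; apply: val_inj.
  - move=> a ne; have /setU1P[E|/imsetP[f1 f1K E]] := valP a.
      case/negP: ne; rewrite (_ : a = e') ?te' ?he' ?piuv //; exact: val_inj.
    by exists (Sub f1 f1K); apply: val_inj.
have [_ _ hqt hqh _] := qt.
have gaN f1 : ga f1 != e'.
  apply/negP => /eqP E; have := loopless f1.
  by rewrite -hqt -hqh E te' he' piuv eqxx.
have fibv x y : pi x = pi y -> x = y \/ pi x = pi v.
  by move=> /fib[|[/piS ? _]]; [left|right].
have fibu x : pi x = pi v -> x = u \/ x = v.
  by move=> /fib[->|[/inS]]; [right|].
have /stronglyP[_ K1c] := K1st.
(* Either [f] leaves [v] and [e] is the only arc into [v], or [f] enters [u] and [e] is the only arc
   out of [u]; a path of [K1] closing up [f] then lifts to the missing part of the way from [v] to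
   [u]. *)
have vu : connect (@arc K') v u.
  pose fK1 : darc K1 := Sub f fK.
  case: hf => -[sole hf].
    have neh f1 : dhead (ga f1) != v.
      apply/negP => /eqP /(congr1 val) /= E; case/negP: (gaN f1); apply/eqP; apply: val_inj.
      exact: sole E.
    have tv : dtail (ga fK1) = v by apply: val_inj.
    have := connect1 (arc_dart (ga fK1)); rewrite tv; move/connect_trans; apply.
    apply: (@connect_to_root _ _ _ (@arc K1) pi u v fibv fibu _ _ (neh _)) => //.
    by move=> X Y /arcP[f1 <- <-]; exists (dtail (ga f1)), (dhead (ga f1)); rewrite hqt hqh neh arc_dart.
  have net f1 : dtail (ga f1) != u.
    apply/negP => /eqP /(congr1 val) /= E; case/negP: (gaN f1); apply/eqP; apply: val_inj.
    exact: sole E.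
  have hu : dhead (ga fK1) = u by apply: val_inj.
  have := connect1 (arc_dart (ga fK1)); rewrite hu; apply: connect_trans.
  have := @connect_to_root _ _ (fun x y => arc y x) (fun X Y : vertex K1 => arc Y X) pi v u.
  rewrite piuv => /(_ fibv) h.
  have := h _ _ (dtail (ga fK1)) (net _).
  rewrite (connect_rev (@arc K1)) /= (connect_rev (@arc K')) /=; apply=> //.
  - by move=> x /fibu[]; [right|left].
  - by move=> X Y /arcP[f1 <- <-]; exists (dhead (ga f1)), (dtail (ga f1)); rewrite hqt hqh net arc_dart.
have uv : connect (@arc K') u v by rewrite -te' -he' connect1 // arc_dart.
exists K'; split.
  apply/stronglyP; split; first by apply/card_gt0P; exists u.
  move=> x y; apply: (@connect_lift _ _ _ (@arc K1) pi predT) => //.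
  - move=> {}x {}y _ _ /fib[->|[/inS xS /inS yS]]; first exact: connect0.
    by case: xS yS => -> [->|->].
  - by move=> X Y /arcP[f1 <- <-]; exists (dtail (ga f1)), (dhead (ga f1)); rewrite hqt hqh arc_dart.
exists (contract [set dtail e'; dhead e']); split.
  apply: rt1n_trans (rt1n_refl _ _ _); apply: ButterflyStep.
  case: hf => -[sole _]; [left|right] => a /(congr1 val) E; apply: val_inj; exact: sole.
have in2 x : x \in [set dtail e'; dhead e'] = (val x \in S).
  by rewrite !inE te' he' -!val_eqE.
apply: (@contract_iso_quotient _ _ pi ga _ u) => //.
- by rewrite in2.
- by move=> x; rewrite in2 piuv; apply: piS.
- by move=> x y; rewrite !in2; apply: fib.
Qed.

End Lift.

Lemma butterfly_step_lift (G D : digraph) (K1 : subdigraph D) :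
  butterfly_step G D -> strongly_connected K1 ->
  exists K' : subdigraph G, strongly_connected K' /\
    exists D', steps butterfly_step K' D' /\ digraph_iso D' K1.
Proof.
move=> st; case: st K1 => e ce K1 K1st.
case: ce => [sole|sole].
  have [[f fK ft]|nof] := classic (exists2 f, f \in sarcs K1 & dtail (val f) = dhead e).
    by apply: (lift_with_arc K1st fK); left.
  apply: (lift_without_arc K1st (w := dhead e) (k := dtail e)) => // [|f fK].
    exact: loopless.
  apply/andP; split; first by apply/eqP => E; apply: nof; exists f.
  apply/eqP => /sole E; have := valP f; by rewrite E !inE !eqxx orbT.
have [[f fK ft]|nof] := classic (exists2 f, f \in sarcs K1 & dhead (val f) = dtail e).
  by apply: (lift_with_arc K1st fK); right.
apply: (lift_without_arc K1st (w := dtail e) (k := dhead e)) => [||f fK].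
- by rewrite setUC.
- by rewrite eq_sym loopless.
apply/andP; split; last by apply/eqP => E; apply: nof; exists f.
apply/eqP => /sole E; have := valP f; by rewrite E !inE !eqxx orbT.
Qed.

Lemma butterfly_steps_lift (G D : digraph) :
  steps butterfly_step G D -> strongly_connected D ->
  exists K' : subdigraph G, strongly_connected K' /\
    exists D', steps butterfly_step K' D' /\ digraph_iso D' D.
Proof.
move=> st Dst; elim: {G D} st Dst => [D|G G1 D s1 _ IH] Dst.
  have iso : digraph_iso (induced [set: vertex D]) D.
    exists val, val; split=> //.
    - by apply: bij_of_surj_inj => [|x]; [apply: val_inj | exists (Sub x (in_setT x))].
    - apply: bij_of_surj_inj => [|x]; first exact: val_inj.
      have xK : x \in sarcs (induced [set: vertex D]) by rewrite !inE.
      by exists (Sub x xK).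
  exists (induced [set: vertex D]); split; first exact: strongly_iso iso Dst.
  by eexists; split; [apply: rt1n_refl | exact: iso].
have [K1 [K1st [D1 [st1 iso1]]]] := IH Dst.
have [K' [K'st [D2 [st2 iso2]]]] := butterfly_step_lift s1 K1st.
have [D3 st3 iso3] := butterfly_steps_iso (digraph_iso_sym iso2) st1.
exists K'; split=> //; exists D3; split.
  by elim: {D2 iso2 K'st} st2 st3 => // x y z xy _ IHst /IHst; apply: rt1n_trans.
exact: digraph_iso_trans (digraph_iso_sym iso3) iso1.
Qed.

Lemma butterfly_localize (H G : digraph) : strongly_connected H ->
  butterfly_minor H G ->
  exists U : {set vertex G}, [/\ U != set0, {in U &, forall x y, connect (@arc G) x y}
    & butterfly_minor H (induced U)].
Proof.
move=> Hst [K [D [st iso]]].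
have [K' [K'st [D' [st' iso']]]] := butterfly_steps_lift st (strongly_iso iso Hst).
have /stronglyP[/card_gt0P[z0 _] K'c] := K'st.
pose U := [set val (val z) | z : vertex K'].
have vU (z : vertex K') : val (val z) \in sverts (induced U) by apply: imset_f.
have aU (a : darc K') : val (val a) \in sarcs (induced U).
  by rewrite inE; have := vU (dtail a); have := vU (dhead a) => /= -> ->.
exists U; split.
- by apply/set0Pn; exists (val (val z0)).
- move=> _ _ /imsetP[x _ ->] /imsetP[y _ ->].
  apply: (@connect_map _ _ _ _ (fun z : vertex K' => val (val z))) (K'c x y) => a b ab.
  apply: connect1; apply: (arc_embedding (sub_embedding K)).
  exact: (arc_embedding (sub_embedding K')).
- apply: (@butterfly_minor_of_embedding H (induced U) K' D'
    (fun z => Sub (val (val z)) (vU z)) (fun a => Sub (val (val a)) (aU a))) => //.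
  + split.
    * by move=> x y /(congr1 val) /= /val_inj /val_inj.
    * by move=> x y /(congr1 val) /= /val_inj /val_inj.
    * by move=> a; apply: val_inj.
    * by move=> a; apply: val_inj.
  + exact: digraph_iso_trans iso' iso.
Qed.

(** * Models in a jungle *)

Lemma exists_injection (T V : finType) (A : {set V}) : #|T| <= #|A| ->
  exists phi : T -> V, injective phi /\ forall t, phi t \in A.
Proof.
move=> le; exists (fun t => enum_val (widen_ord le (enum_rank t))); split.
  by move=> x y /enum_val_inj /(congr1 val) /= /val_inj /enum_rank_inj.
by move=> t; apply: enum_valP.
Qed.

Lemma diwalk_tails (G : digraph) (u v : vertex G) q : diwalk u q v ->
  rcons (map (@dtail G) q) v = u :: map (@dhead G) q.
Proof.
elim: q u => [|b q IH] u /=; first by move/eqP->.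
by move=> /andP[/eqP <- /IH ->].
Qed.

Lemma inner_of_heads (G : digraph) (u v : vertex G) q p : diwalk u q v ->
  map (@dhead G) q = rcons p v -> inner_vertices q = p.
Proof.
case: q => [|b q] /=; first by case: p.
by move=> /andP[_ /diwalk_tails E] E2; have := rcons_inj (etrans E E2) => -[].
Qed.

Lemma long_walk_inner (G : digraph) (u v : vertex G) q a : diwalk u q v ->
  inner_vertices q != [::] -> a \in q ->
  dtail a \in inner_vertices q \/ dhead a \in inner_vertices q.
Proof.
rewrite /inner_vertices; case: q => [|b [|c q]] //= /and3P[_ /eqP cb _] _.
rewrite inE => /predU1P[->|aq]; first by right; rewrite -cb mem_head.
by left; rewrite -map_cons; apply: map_f.
Qed.

Lemma jungle_topo (H G : digraph) m (Y F0 : {set vertex G}) :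
  jungle (@arc G) m Y -> #|F0| + #|vertex H| <= #|Y| ->
  #|F0| + #|vertex H| + 4 * #|darc H| <= m ->
  exists U : {set vertex G}, [/\ [disjoint U & F0],
    #|U| <= #|vertex H| + 4 * #|darc H| & topological_minor H (induced U)].
Proof.
move=> jY bigY bigm.
have [|phi [phi_inj phiY]] := @exists_injection (vertex H) _ (Y :\: F0).
  by rewrite cardsD; have := subset_leq_card (subsetIr Y F0); lia.
have cphi : #|phi @: setT| = #|vertex H| by rewrite card_imset // cardsT.
have [||p [hp dp]] := linkage (F0 := F0 :|: phi @: setT) (src := fun e : darc H => phi (dtail e))
    (dst := fun e => phi (dhead e)) jY.
- by have := card_setU_le F0 (phi @: setT); lia.
- move=> e; have := phiY (dtail e); have := phiY (dhead e); rewrite !inE.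
  by move=> /andP[_ ->] /andP[_ ->]; rewrite (inj_eq phi_inj) loopless.
have /choice_fun[P hP] e : exists q, dipath (phi (dtail e)) q (phi (dhead e)) /\ inner_vertices q = p e.
  case: (hp e) => pth un _ _; have [q [dq hq]] := dipath_of_path pth un.
  rewrite last_rcons in dq; exists q; split=> //.
  by case/andP: dq => wq _; apply: inner_of_heads wq hq.
have innP e : inner_vertices (P e) = p e by case: (hP e).
have wk e : diwalk (phi (dtail e)) (P e) (phi (dhead e)) by case: (hP e) => /andP[].
have pF e x : x \in p e -> (x \notin F0) /\ forall v, phi v != x.
  case: (hp e) => _ _ _ /allP h /h; rewrite inE negb_or => /andP[xF xphi]; split=> // v.
  by apply: contraNneq xphi => <-; apply: imset_f.
have m' : @topo_model H G phi P.
  split=> //.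
  - by move=> e; case: (hP e).
  - by move=> e v; rewrite innP; apply/negP => /pF[_ /(_ v)]; rewrite eqxx.
  - by move=> e e' x; rewrite !innP; apply: dp.
  (* As [P e] has an inner vertex, each of its arcs has an end in [p e]; that end is no branch
     vertex, so on [P e'] it must be an inner vertex too. *)
  - move=> e e' a ae ae'.
    have ne : inner_vertices (P e) != [::].
      by rewrite innP -size_eq0; case: (hp e) => _ _ /andP[]; case: (size _).
    have key x : x \in p e -> x = phi (dtail e') \/ x = phi (dhead e') \/ x \in p e' -> e = e'.
      move=> xe [E|[E|]]; last exact: dp.
      + by case: (pF e x xe) => _ /(_ (dtail e')); rewrite E eqxx.
      + by case: (pF e x xe) => _ /(_ (dhead e')); rewrite E eqxx.
    have := diwalk_ends (wk e') ae'; have := long_walk_inner (wk e) ne ae.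
    rewrite !innP => -[xe|xe] [ht hh]; apply: (key _ xe).
      by case: ht; [left | right; right].
    by case: hh => h; right; [left | right].
pose U := phi @: setT :|: [set x in flatten [seq p e | e <- enum (darc H)]].
have Uinn e x : x \in p e -> x \in U.
  by move=> xe; rewrite !inE; apply/orP; right; apply/flatten_mapP; exists e; rewrite ?mem_enum.
exists U; split.
- rewrite disjoint_subset; apply/subsetP => x; rewrite !inE => /orP[/imsetP[v _ ->]|].
    by have := phiY v; rewrite inE => /andP[].
  by move=> /flatten_mapP[e _ /pF[]].
- apply: leq_trans (card_setU_le _ _) _; rewrite cphi leq_add2l [#|darc H|]cardE.
  by apply: card_flatten_le => e _; case: (hp e) => _ _ /andP[].
- apply: topo_minor_induced m' _ _ => [v|e x]; last by rewrite innP; apply: Uinn.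
  by rewrite !inE imset_f.
Qed.

Lemma strong_model_induced (H G : digraph) (U : {set vertex G}) B al :
  @strong_model H G B al -> (forall h, B h \subset U) -> strong_minor H (induced U).
Proof.
move=> [B0 Bst Bdis alinj alB] BU.
have alU e : al e \in sarcs (induced U).
  by case: (alB e) => h1 h2; rewrite inE (subsetP (BU _) _ h1) (subsetP (BU _) _ h2).
apply: (@strong_model_minor _ (induced U) (fun h => [set z | val z \in B h])
         (fun e => Sub (al e) (alU e))); split.
- move=> h; have /set0Pn[x xh] := B0 h; have xU : x \in sverts (induced U) by apply: (subsetP (BU h)).
  by apply/set0Pn; exists (Sub x xU); rewrite inE.
- move=> h x y; rewrite !inE => xh yh; apply: connect_sub => //; last exact: Bst.
  by move=> u v /and3P[uh vh /arcP[e et eh]]; exists e; rewrite // inE et eh (subsetP (BU h) _ uh) (subsetP (BU h) _ vh).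
- by move=> h h' x; rewrite !inE; apply: Bdis.
- by move=> e e' /(congr1 val) /alinj.
- by move=> e; rewrite !inE; apply: alB.
Qed.

Lemma path_rel_in (G : digraph) (B : {set vertex G}) u p :
  path (@arc G) u p -> {subset u :: p <= B} -> path (rel_in B) u p.
Proof.
elim: p u => //= x p IH u /andP[ux xp] sub; apply/andP; split.
  by rewrite /rel_in ux !sub // !inE eqxx ?orbT.
by apply: IH xp _ => z zp; apply: sub; rewrite inE zp orbT.
Qed.

Lemma connect_last (T : finType) (r : rel T) u p x :
  path r u p -> x \in u :: p -> connect r x (last u p).
Proof.
move=> pth /splitPl sp; case: sp pth => p1 p2 <-; rewrite cat_path last_cat => /andP[_ p2h].
by apply/connectP; exists p2.
Qed.

Lemma semicomplete_arc (s : nat) (G : digraph) : semicomplete s G ->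
  forall v : vertex G, #|[set w | (w != v) && ~~ (arc v w || arc w v)]| <= s.
Proof.
move=> semi v; apply: leq_trans (semi v); apply: subset_leq_card.
by apply/subsetP => w; rewrite !inE adjacentE.
Qed.

(** Every branch set gets one triple per arc of [H], which makes the chosen arcs distinct; [None]
    keeps it nonempty when [H] has no arcs. *)
Definition strong_index (H : digraph) : finType := (option (darc H) * vertex H)%type.

(* Three consecutive pieces of a transitive chain in the jungle give vertices
   [fA q -> fB q' -> fC q''], and disjoint paths from [fC q] back to [fA q] close
   the triples up to disjoint strong sets with arcs between any two of them. *)
Lemma jungle_strong (s : nat) (H G : digraph) m (Y F0 : {set vertex G}) :
  semicomplete s G -> jungle (@arc G) m Y ->
  #|F0| + chain_const s (3 * #|strong_index H|) <= #|Y| ->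
  #|F0| + 7 * #|strong_index H| <= m ->
  exists U : {set vertex G}, [/\ [disjoint U & F0],
    #|U| <= 7 * #|strong_index H| & strong_minor H (induced U)].
Proof.
move=> semi jY bigY bigm; set n := #|strong_index H| in bigY bigm *.
have [|t [st ut tY pt]] := @exists_chain _ (@arc G) s (@arc_irr G) (semicomplete_arc semi) (3 * n) (Y :\: F0).
  by rewrite cardsD; have := subset_leq_card (subsetIr Y F0); lia.
have bnd j (q : strong_index H) : j < 3 -> j * n + enum_rank q < 3 * n.
  by have := ltn_ord (enum_rank q); rewrite -/n; nia.
have [c [c_inj cY cA]] : exists c : nat -> strong_index H -> vertex G,
    [/\ forall j j' q q', j < 3 -> j' < 3 -> c j q = c j' q' -> j = j' /\ q = q',
        forall j q, j < 3 -> c j q \in Y :\: F0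
      & forall j j' q q', j < j' -> j' < 3 -> arc (c j q) (c j' q')].
  case: t st ut tY pt => [|x0 t'] st ut tY pt.
    have no (q : strong_index H) : False by have := bnd 0 q isT; rewrite -st.
    by exists (fun _ q => match no q with end); split=> [j j' q|j q|j j' q]; case: (no q).
  exists (fun j q => nth x0 (x0 :: t') (j * n + enum_rank q)); split.
  - move=> j j' q q' j3 j'3 /eqP; rewrite nth_uniq // ?st ?bnd // => /eqP E.
    have lq := ltn_ord (enum_rank q); have lq' := ltn_ord (enum_rank q').
    rewrite -/n in lq lq'.
    have div k r : r < n -> (k * n + r) %/ n = k.
      by move=> rn; rewrite divnMDl ?divn_small ?addn0 //; lia.
    have Ej : j = j' by rewrite -(div j _ lq) E div.
    by split=> //; apply: enum_rank_inj; apply: val_inj; move: E; rewrite Ej => /addnI.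
  - by move=> j q j3; apply: tY; apply: mem_nth; rewrite st bnd.
  - move=> j j' q q' jj' j'3; move/(pairwiseP x0): pt; apply.
    + by rewrite inE st bnd //; lia.
    + by rewrite inE st bnd.
    + by have := leq_mul jj' (leqnn n); have := ltn_ord (enum_rank q); rewrite -/n; lia.
pose fA := c 0; pose fB := c 1; pose fC := c 2.
pose C := [set c (nat_of_ord u.1) u.2 | u : 'I_3 * strong_index H].
have cC : #|C| <= 3 * n.
  by apply: leq_trans (leq_imset_card _ _) _; rewrite card_prod card_ord.
have inC j q : j < 3 -> c j q \in C.
  by move=> j3; apply/imsetP; exists (Ordinal j3, q).
have [||p [hp dp]] := linkage (F0 := F0 :|: C) (src := fC) (dst := fA) jY.
- by have := card_setU_le F0 C; lia.
- move=> q; have := cY 0 q isT; have := cY 2 q isT; rewrite !inE => /andP[_ ->] /andP[_ ->].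
  by split=> //; apply/eqP => /(c_inj 2 0 _ _ isT isT)[].
have pF q x : x \in p q -> (x \notin F0) /\ forall j q', j < 3 -> c j q' != x.
  case: (hp q) => _ _ _ /allP h /h; rewrite inE negb_or => /andP[xF xC]; split=> // j q' j3.
  by apply: contraNneq xC => <-; apply: inC.
pose inS q x := (exists2 j, j < 3 & x = c j q) \/ x \in p q.
have Sdis q q' x : inS q x -> inS q' x -> q = q'.
  move=> [[j j3 ->]|xq] [[j' j'3 E]|xq']; last exact: dp xq xq'.
  - by case: (c_inj _ _ _ _ j3 j'3 E).
  - by case: (pF _ _ xq') => _ /(_ j q j3); rewrite eqxx.
  - by case: (pF _ _ xq) => _ /(_ j' q' j'3); rewrite E eqxx.
pose B h := [set x | [exists o, (x \in [seq c j (o, h) | j <- iota 0 3]) || (x \in p (o, h))]].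
have BP h x : reflect (exists o, inS (o, h) x) (x \in B h).
  rewrite inE; apply: (iffP existsP) => -[o ho]; exists o.
    case/orP: ho => [/mapP[j]|]; last by right.
    by rewrite mem_iota => j3 ->; left; exists j.
  apply/orP; case: ho => [[j j3 ->]|]; last by right.
  by left; apply: map_f; rewrite mem_iota.
have cB j o h : j < 3 -> c j (o, h) \in B h.
  by move=> j3; apply/BP; exists o; left; exists j.
have Bstep h j j' o o' : j < j' -> j' < 3 ->
    connect (rel_in (B h)) (c j (o, h)) (c j' (o', h)).
  by move=> jj' j'3; apply: connect1; rewrite /rel_in !cB ?cA //; lia.
have pthB o h : path (rel_in (B h)) (fC (o, h)) (rcons (p (o, h)) (fA (o, h))).
  case: (hp (o, h)) => pth _ _ _; apply: path_rel_in pth _ => x.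
  rewrite inE mem_rcons inE => /predU1P[->|/predU1P[->|xp]]; try exact: cB.
  by apply/BP; exists o; right.
have Sto o h x : inS (o, h) x -> connect (rel_in (B h)) x (fA (o, h)).
  have fromC : connect (rel_in (B h)) (fC (o, h)) (fA (o, h)).
    by have := connect_last (pthB o h) (mem_head _ _); rewrite last_rcons.
  case=> [[[|[|[|//]]] _ ->]|xp]; first exact: connect0.
  - by apply: connect_trans fromC; apply: Bstep.
  - exact: fromC.
  - have := connect_last (x := x) (pthB o h); rewrite last_rcons; apply.
    by rewrite inE mem_rcons inE xp !orbT.
(* In the chain, [fA] of any piece precedes [fC] of every piece; this links the pieces of one branch
   set. *)
have Sfrom o o' h x : inS (o', h) x -> connect (rel_in (B h)) (fA (o, h)) x.
  have toC : connect (rel_in (B h)) (fA (o, h)) (fC (o', h)) by apply: Bstep.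
  case=> [[[|[|[|//]]] _ ->]|xp].
  - apply: connect_trans toC _; apply: (path_connect (pthB o' h)).
    by rewrite inE mem_rcons mem_head orbT.
  - exact: Bstep.
  - exact: toC.
  - apply: connect_trans toC _; apply: (path_connect (pthB o' h)).
    by rewrite inE mem_rcons inE xp !orbT.
(* The tail lies in the piece indexed by [e] itself, whence the injectivity of [al]. *)
have /choice_fun[al hal] e : exists b : darc G,
    dtail b = fA (Some e, dtail e) /\ dhead b = fB (Some e, dhead e).
  have /arcP[b bt bh] := cA 0 1 (Some e, dtail e) (Some e, dhead e) isT isT.
  by exists b.
have model : strong_model B al.
  split.
  - by move=> h; apply/set0Pn; exists (fA (None, h)); apply: cB.
  - move=> h x y /BP[o xo] /BP[o' yo'].
    exact: connect_trans (Sto _ _ _ xo) (Sfrom _ _ _ _ yo').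
  - by move=> h h' x /BP[o xo] /BP[o' xo']; case: (Sdis _ _ _ xo xo').
  - move=> e e' E; case: (hal e) (hal e') => h1 _ [h2 _]; move: h2; rewrite -E h1.
    by case/(c_inj 0 0 _ _ isT isT) => _ [].
  - by move=> e; case: (hal e) => -> ->; rewrite !cB.
pose U := C :|: [set x in flatten [seq p q | q <- enum (strong_index H)]].
exists U; split.
- rewrite disjoint_subset; apply/subsetP => x; rewrite !inE => /orP[/imsetP[u _ ->]|].
    by have := cY _ u.2 (ltn_ord u.1); rewrite inE => /andP[].
  by move=> /flatten_mapP[q _ /pF[]].
(* Each index uses three chain vertices and at most four inner vertices. *)
- apply: leq_trans (card_setU_le _ _) _; rewrite (_ : 7 * n = 3 * n + 4 * n); last by lia.
  apply: leq_add cC _; rewrite /n [#|strong_index H|]cardE.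
  by apply: card_flatten_le => q _; case: (hp q) => _ _ /andP[].
- apply: strong_model_induced model _ => h; apply/subsetP => x /BP[o [[j j3 ->]|xp]].
    by rewrite inE inC.
  rewrite !inE; apply/orP; right; apply/flatten_mapP; exists (o, h) => //.
  by rewrite mem_enum.
Qed.

(** * The Erdos-Posa property *)

(** Small models are taken one after another, each avoiding the vertices already used. *)
Lemma greedy_packing (minor : digraph -> digraph -> Prop) (H G : digraph) (k c : nat) :
  (forall F0 : {set vertex G}, #|F0| <= k * c -> exists U : {set vertex G},
     [/\ [disjoint U & F0], #|U| <= c & minor H (induced U)]) ->
  minor_packing minor H G k.
Proof.
move=> next.
suff [U [F [_ _ hU dU]]] : exists (U : nat -> {set vertex G}) (F : {set vertex G}),
    [/\ #|F| <= k * c, forall j, j < k -> U j \subset F,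
        forall j, j < k -> minor H (induced (U j))
      & forall j j', j < j' -> j' < k -> [disjoint U j & U j']].
  exists (fun j => induced (U j)); split=> [i j ij|i]; last exact: hU.
  move: ij; rewrite -val_eqE /= neq_ltn => /orP[] lt; first exact: dU lt _.
  by rewrite disjoint_sym; apply: dU lt _.
suff /(_ k (leqnn k)) : forall i, i <= k ->
    exists (U : nat -> {set vertex G}) (F : {set vertex G}),
    [/\ #|F| <= i * c, forall j, j < i -> U j \subset F,
        forall j, j < i -> minor H (induced (U j))
      & forall j j', j < j' -> j' < i -> [disjoint U j & U j']] by [].
elim=> [|i IH] ik; first by exists (fun=> set0), set0; rewrite cards0.
have [U [F [cF UF hU dU]]] := IH (ltnW ik).
have [|V [VF cV hV]] := next F; first by apply: leq_trans cF _; rewrite leq_mul2r ltnW ?orbT.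
exists (fun j => if j == i then V else U j), (F :|: V); split.
- by apply: leq_trans (card_setU_le _ _) _; rewrite mulSn addnC leq_add.
- move=> j; rewrite ltnS leq_eqVlt; case: eqP => [_ _|_ /= /UF sub]; first exact: subsetUr.
  by apply: subset_trans sub (subsetUl _ _).
- by move=> j; rewrite ltnS leq_eqVlt; case: eqP => // _ /= /hU.
- move=> j j' jj' j'i; rewrite (ltn_eqF (leq_trans jj' j'i)).
  move: j'i; rewrite ltnS leq_eqVlt; case: eqP => [E _|_ /=]; last exact: dU.
  by rewrite disjoint_sym; apply: disjointWr VF; apply: UF; rewrite -E.
Qed.

Definition minor_monotone (minor : digraph -> digraph -> Prop) :=
  forall H G1 G2 f g, @embedding G1 G2 f g -> minor H G1 -> minor H G2.

Lemma strong_minor_monotone : minor_monotone strong_minor.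
Proof.
move=> H G1 G2 f g em /strong_minor_model[B [al m]].
exact: strong_model_minor (strong_model_embedding em m).
Qed.

Lemma topological_minor_monotone : minor_monotone topological_minor.
Proof.
move=> H G1 G2 f g em /topo_minor_model[phi [P m]].
exact: topo_model_minor (topo_embedding em m).
Qed.

Lemma butterfly_minor_monotone : minor_monotone butterfly_minor.
Proof.
move=> H G1 G2 f g [finj ginj ht hh] [K [D [st iso]]].
apply: (@butterfly_minor_of_embedding H G2 K D (f \o val) (g \o val)) => //.
split; try by [apply: inj_comp val_inj | move=> e /=; rewrite ?ht ?hh].
Qed.

(** Connection is required in [G] rather than inside [S i]: with [delete_vertices X] as [G], this
    already prevents a part from straddling a cut. Parts may overlap. *)
Definition localizable (minor : digraph -> digraph -> Prop) (H : digraph) (d : nat) :=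
  forall G, minor H G -> exists S : 'I_d -> {set vertex G},
    [/\ forall i, S i != set0, forall i, {in S i &, forall x y, connect (@arc G) x y}
      & minor H (induced (\bigcup_i S i))].

Lemma strong_minor_localizable H : localizable strong_minor H #|vertex H|.
Proof.
move=> G /strong_minor_model[B [al m]]; have [B0 Bst _ _ _] := m.
exists (fun i => B (enum_val i)); split=> [i|i x y xi yi|].
- exact: B0.
- by apply: (@connect_map _ _ _ _ id) (Bst _ x y xi yi) => u v /and3P[_ _]; apply: connect1.
- apply: strong_model_induced m _ => h; apply/subsetP => x xh.
  by apply/bigcupP; exists (enum_rank h); rewrite ?enum_rankK.
Qed.

Lemma localizable1 minor H :
  (forall G, minor H G -> exists U : {set vertex G},
     [/\ U != set0, {in U &, forall x y, connect (@arc G) x y} & minor H (induced U)]) ->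
  localizable minor H 1.
Proof.
move=> loc G /loc[U [U0 Uc UH]]; exists (fun=> U); split=> //.
by rewrite big_ord1.
Qed.

Lemma set_hull (T : finType) (pos : T -> nat) (S : {set T}) : S != set0 ->
  exists I : nat * nat,
    [/\ exists2 x, x \in S & pos x = I.1, exists2 x, x \in S & pos x = I.2
      & forall x, x \in S -> in_itv (pos x) I].
Proof.
move=> /set0Pn[x0 x0S]; exists (pos [arg min_(x < x0 in S) pos x], pos [arg max_(x > x0 in S) pos x]).
case: arg_minnP => // x xS minx; case: arg_maxnP => // y yS maxy; split.
- by exists x.
- by exists y.
- by move=> z zS; apply/andP; split; [apply: minx | apply: maxy].
Qed.

Section Hulls.

Variables (minor : digraph -> digraph -> Prop) (H G : digraph) (d : nat).
Variable pos : vertex G -> nat.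

(** Connectivity of the parts is not recorded: it is exploited only in the digraph left after
    deletion. *)
Definition hulls (A : seq (nat * nat)) := exists S : 'I_d -> {set vertex G},
  [/\ size A = d, minor H (induced (\bigcup_i S i)),
      forall i x, x \in S i -> in_itv (pos x) (nth (0, 0) A i)
    & forall i, (exists2 x, x \in S i & pos x = (nth (0, 0) A i).1) /\
                (exists2 x, x \in S i & pos x = (nth (0, 0) A i).2)].

Lemma hulls_family : itv_family d hulls.
Proof.
move=> A [S [sz _ inS endS]]; split=> //; apply/(all_nthP (0, 0)) => i; rewrite sz => id.
have [[x xS _] _] := endS (Ordinal id).
by have /andP[] := inS _ _ xS => /= h1 h2; apply: leq_trans h1 h2.
Qed.

Lemma hulls_packing k : itv_packing hulls k -> minor_packing minor H G k.
Proof.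
move=> [A [hA apA]].
have [S hS] := choice_fun (fun j : 'I_k => hA j (ltn_ord j)).
exists (fun j => induced (\bigcup_i S j i)); split=> [j j' jj'|j]; last by case: (hS j).
rewrite /= disjoint_subset; apply/subsetP => x /bigcupP[i _ xi]; rewrite inE.
apply/negP => /bigcupP[i' _ xi'].
have cov l r : x \in S l r -> covers (pos x) (A l).
  case: (hS l) => sz _ inS _ xr; apply/hasP; exists (nth (0, 0) (A l) r); last exact: inS.
  by apply: mem_nth; rewrite sz.
have := apA j j' (ltn_ord j) (ltn_ord j') jj' (pos x).
by rewrite (cov _ _ xi) (cov _ _ xi').
Qed.

(** A model surviving the deletion would have a span met at some [p]; one of its parts would then
    contain a path crossing [p] upwards although [Z p] is deleted. *)
Lemma hulls_cover t w (Z : nat -> {set vertex G}) :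
  minor_monotone minor -> localizable minor H d -> injective pos ->
  (forall p, #|Z p| <= w /\
     forall x y, arc x y -> pos x < p -> p <= pos y -> (x \in Z p) || (y \in Z p)) ->
  itv_cover hulls t -> minor_cover minor H G (t * w.+1).
Proof.
move=> mono loc pos_inj hZ [ps [szps hps]].
(* Deleting the vertex at position [p] as well leaves the low end of a pierced span strictly below
   [p]; hence [w.+1]. *)
pose Zp p := [set v | pos v == p] :|: Z p.
pose X := \bigcup_(p <- ps) Zp p.
have cX : #|X| <= size ps * w.+1.
  rewrite /X; elim: (ps) => [|p l IH]; first by rewrite big_nil cards0.
  rewrite big_cons mulSn; apply: leq_trans (card_setU_le _ _) _; apply: leq_add IH.
  apply: leq_trans (card_setU_le _ _) _; rewrite -add1n; apply: leq_add; last by case: (hZ p).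
  apply/card_le1P => x; rewrite inE => /eqP Ex y; rewrite !inE.
  by rewrite -Ex (inj_eq pos_inj).
have ZpX p v : p \in ps -> v \in Zp p -> v \in X.
  move=> + vp; rewrite /X; elim: (ps) => // q l IH.
  by rewrite inE big_cons inE => /predU1P[<-|/IH ->]; rewrite ?vp ?orbT.
exists X; split; first by apply: leq_trans cX _; rewrite leq_mul2r szps orbT.
move=> /loc[S' [S'0 S'c S'H]].
pose S i := [set val z | z in S' i] : {set vertex G}.
have /choice_fun[I hI] i : exists I : nat * nat,
    [/\ exists2 x, x \in S i & pos x = I.1, exists2 x, x \in S i & pos x = I.2
      & forall x, x \in S i -> in_itv (pos x) I].
  apply: set_hull; have /set0Pn[z zS] := S'0 i.
  by apply/set0Pn; exists (val z); apply: imset_f.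
pose A := [seq I i | i <- enum 'I_d].
have nthA (i : 'I_d) : nth (0, 0) A i = I i.
  by rewrite (nth_map i) ?size_enum_ord // nth_ord_enum.
have szA : size A = d by rewrite size_map size_enum_ord.
have hA : hulls A.
  exists S; split=> //.
  - have vU (z : vertex (induced (\bigcup_i S' i))) :
        val (val z) \in sverts (induced (\bigcup_i S i)).
      have /bigcupP[i _ zi] := valP z.
      by apply/bigcupP; exists i => //; apply: imset_f.
    have aU (a : darc (induced (\bigcup_i S' i))) :
        val (val a) \in sarcs (induced (\bigcup_i S i)).
      by have h1 := vU (dtail a); have h2 := vU (dhead a); rewrite inE; apply/andP.
    apply: (@mono H (induced (\bigcup_i S' i)) (induced (\bigcup_i S i))
      (fun z => Sub (val (val z)) (vU z))
                        (fun a => Sub (val (val a)) (aU a)) _ S'H).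
    split.
    + by move=> x y /(congr1 val) /= /val_inj /val_inj.
    + by move=> x y /(congr1 val) /= /val_inj /val_inj.
    + by move=> a; apply: val_inj.
    + by move=> a; apply: val_inj.
  - by move=> i x; rewrite nthA; case: (hI i) => _ _; apply.
  - by move=> i; rewrite nthA; case: (hI i).
have /hasP[p pps /(has_nthP (0, 0))[j]] := hps A hA.
rewrite szA => jd; rewrite (nthA (Ordinal jd)) => /andP[lo hi].
have [[x /imsetP[x' x'S ->] Ex] [y /imsetP[y' y'S ->] Ey] _] := hI (Ordinal jd).
have notX (z : vertex (delete_vertices X)) : pos (val z) != p /\ val z \notin Z p.
  have := valP z; rewrite inE => zX.
  have : val z \notin Zp p.
    by apply: contraNN zX; apply: ZpX.
  by rewrite !inE negb_or => /andP[].
have stay u v : connect (@arc (delete_vertices X)) u v -> pos (val u) < p -> pos (val v) < p.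
  move=> /connectP[q]; elim: q u => [|z q IH] u /=; first by move=> _ ->.
  move=> /andP[/arcP[e eu ez] pq] lv up; apply: (IH z pq lv).
  rewrite ltnNge; apply/negP => pz.
  have uz : arc (val u) (val z) by rewrite -eu -ez; apply: arc_dart.
  case: (hZ p) => _ /(_ _ _ uz up pz).
  by case: (notX u) => _ /negPf ->; case: (notX z) => _ /negPf ->.
have xp : pos (val x') < p by rewrite ltn_neqAle (notX x').1 Ex.
by have := stay _ _ (S'c _ x' y' x'S y'S) xp; rewrite ltnNge Ey hi.
Qed.

End Hulls.

Theorem erdos_posa (minor : digraph -> digraph -> Prop) (H : digraph) (d s : nat) :
  minor_monotone minor -> localizable minor H d ->
  (forall k, exists N m, forall G (Y : {set vertex G}), semicomplete s G ->
     #|Y| = N -> jungle (@arc G) m Y -> minor_packing minor H G k) ->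
  exists f : nat -> nat, forall G, semicomplete s G -> forall k, 0 < k ->
    minor_packing minor H G k \/ minor_cover minor H G (f k).
Proof.
move=> mono loc pack.
suff h k : exists n, forall G, semicomplete s G ->
    minor_packing minor H G k \/ minor_cover minor H G n.
  by have [f hf] := choice_fun h; exists f => G semi k _; apply: hf.
have [N [m hN]] := pack k; have [t ht] := itv_packing_or_cover d k.
exists (t * (cut_width s m N).+1) => G semi.
have [[Y [cY jY]]|cuts] := jungle_or_cuts (@arc_irr G) (semicomplete_arc semi) m N.
  by left; apply: hN semi cY jY.
have [Z hZ] := choice_fun cuts.
have [pk|cov] := ht _ (@hulls_family minor H G d (pos (@arc G))).
  by left; apply: hulls_packing pk.
right; apply: hulls_cover hZ cov => //; exact: pos_inj.
Qed.

Lemma topo_jungle_packing (H : digraph) (k : nat) : exists N m,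
  forall G (Y : {set vertex G}), #|Y| = N -> jungle (@arc G) m Y ->
    minor_packing topological_minor H G k.
Proof.
pose c := #|vertex H| + 4 * #|darc H|.
exists (k * c + c), (k * c + c) => G Y cY jY; apply: (@greedy_packing _ _ _ _ c) => F0 cF.
by apply: jungle_topo jY _ _; rewrite ?cY /c in cF *; lia.
Qed.

Lemma strong_jungle_packing (s : nat) (H : digraph) (k : nat) : exists N m,
  forall G (Y : {set vertex G}), semicomplete s G -> #|Y| = N -> jungle (@arc G) m Y ->
    minor_packing strong_minor H G k.
Proof.
pose c := 7 * #|strong_index H|.
exists (k * c + chain_const s (3 * #|strong_index H|)), (k * c + c) => G Y semi cY jY.
apply: (@greedy_packing _ _ _ _ c) => F0 cF.
by apply: (jungle_strong semi jY); rewrite ?cY /c in cF *; lia.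
Qed.

Theorem theorem2 (H : digraph) :
  (forall s : nat, exists f : nat -> nat,
     forall G : digraph, semicomplete s G -> forall k : nat, 0 < k ->
       minor_packing strong_minor H G k \/ minor_cover strong_minor H G (f k))
  /\
  (strongly_connected H ->
     (forall s : nat, exists f : nat -> nat,
        forall G : digraph, semicomplete s G -> forall k : nat, 0 < k ->
          minor_packing butterfly_minor H G k \/
          minor_cover butterfly_minor H G (f k))
     /\
     (forall s : nat, exists f : nat -> nat,
        forall G : digraph, semicomplete s G -> forall k : nat, 0 < k ->
          minor_packing topological_minor H G k \/
          minor_cover topological_minor H G (f k))).
Proof.
split=> [s|Hst].
  apply: erdos_posa (@strong_minor_localizable H) _; first exact: strong_minor_monotone.
  exact: strong_jungle_packing.
split=> s.
  apply: (@erdos_posa _ H 1); first exact: butterfly_minor_monotone.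
    by apply: localizable1 => G; apply: butterfly_localize.
  (* Topological models in the jungle become butterfly models by shrinking the subdivided arcs. *)
  move=> k; have [N [m h]] := topo_jungle_packing H k; exists N, m => G Y _ cY jY.
  have [F [dF hF]] := h G Y cY jY; exists F; split=> // i; exact: topo_butterfly.
apply: (@erdos_posa _ H 1); first exact: topological_minor_monotone.
  by apply: localizable1 => G; apply: topo_localize.
by move=> k; have [N [m h]] := topo_jungle_packing H k; exists N, m => G Y _; apply: h.
Qed.
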